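(* Let $T,S$ be two $n$-SLTM with $T\nsim 0_n$ and $S\nsim 0_n$. If $T\sim S$, then $\mathbb{M}(T)=\mathbb{M}(S)$.
   Context: Let $\mathbb{F}$ be a field of characteristic different from $2$. An $n$-SLTM is a strictly lower triangular $n\times n$ matrix with entries in $\mathbb{F}$; $0_n$ is the zero matrix. For an $n$-SLTM $T=[t_{ij}]$, $\mathcal{A}(T)$ is the commutative unital $\mathbb{F}$-algebra with generators $X_1,\dots,X_n$ and relations $X_1^2=0$ and $X_i^2=\sum_{j<i}t_{ij}X_jX_i$ for $2\le i\le n$, graded by $\deg(X_i)=2$. For two $n$-SLTM $T,S$, write $T\sim S$ if there is a degree-preserving isomorphism of $\mathbb{F}$-algebras $\mathcal{A}(T)\to\mathcal{A}(S)$; this is an equivalence relation. Intervals are intervals of integers: $[a,b]=\{m:a\le m\le b\}$, $[a,b[=\{m:a\le m<b\}$, $]a,b]=\{m:a<m\le b\}$, $]a,b[=\{m:a<m<b\}$. For an $n$-SLTM $T$, $T^{[r]}$ is its $r$-th row, and $T^{[r]}_J$ is the row of entries $t_{rj}$ with $j\in J$. For a matrix $M$, $\mu(M)$ is the number of nonzero entries of $M$. For $r\in[1,n]$ let $c_r=\max\{j:t_{rj}\ne 0\}$ if $T^{[r]}\neq 0$ and $c_r=0$ otherwise. If $c_r>0$, $t_{r,c_r}$ is the leader of the $r$-th row and $(r,c_r)$ is its leader position. For $\alpha\in\mathbb{F}$ and $1\le i<j<k\le n$ put $\Delta^{(\alpha)}_{i,j,k}(T)=\alpha t_{ki}+t_{kj}t_{ji}$.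 First reduced echelon form ($1$-REF): an $n$-SLTM $S\ne 0_n$ is in $1$-REF if (1) all zero rows of $S$ are above all nonzero rows; (2) for each leader position $(r,c)$ we have $c>1$ and there is $i_0\in[1,c[$ with $\Delta^{(2)}_{i_0,c,r}(S)\neq 0$; (3) if $(r,c_r)$ and $(r+1,c_{r+1})$ are leader positions of rows $r$ and $r+1$, then $c_r\le c_{r+1}$. The zero matrix is also in $1$-REF. Wall: for $S\neq 0_n$ in $1$-REF define recursively $r_1=\min\{r\in[1,n]:S^{[r]}\ne 0\}$ and, given $r_j$, let $A_j=\{r\in\,]r_j,n]: c_r\ge r_j\}$; if $A_j\neq\emptyset$ put $r_{j+1}=\min(A_j)$; if $A_j=\emptyset$ stop and put $\mathbb{W}(S)=(r_1,\dots,r_j)$. Also $\mathbb{W}(0_n)=(0)$. For an arbitrary $n$-SLTM $T$, $\mathbb{W}(T):=\mathbb{W}(S)$ where $S$ is any matrix in $1$-REF with $T\sim S$ (such $S$ exists and the value does not depend on the choice). When $\mathbb{W}(T)=(r_1,\dots,r_h)$ put $r_0=1$ and $r_{h+1}=n+1$. Second reduced echelon form ($2$-REF): an $n$-SLTM $T\nsim 0_n$ with $\mathbb{W}(T)=(r_1,\dots,r_h)$ is in $2$-REF if (1) $T$ has exactly $r_1-1$ zero rows and they are above the nonzero rows; (2) for each leader position $(r,c_r)$ we have $c_r>1$ and there is $i_0\in[1,c_r[$ with $\Delta^{(2)}_{i_0,c_r,r}(T)\ne 0$; moreover for each $j\in[1,h]$ and $r\in[r_j,r_{j+1}[$ we have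 $c_r\in[r_{j-1},r_j[$; (3) for each $j\in[1,h]$ and $r\in[r_j,r_{j+1}-1[$, $\mu(T^{[r]}_{[r_{j-1},r_j[})\le\mu(T^{[r+1]}_{[r_{j-1},r_j[})$. The zero matrix is also said to be in $2$-REF. Measure sequence: let $V\nsim 0_n$ be in $2$-REF with $\mathbb{W}(V)=(r_1,\dots,r_h)$. For each $j\in[1,h]$ put $r_{j1}=r_j$, $\mu_{j1}=\mu(V^{[r_{j1}]}_{[r_{j-1},r_j[})$. Given $r_{jk},\mu_{jk}$, let $A_{jk}=\{r\in\,]r_{jk},r_{j+1}[\;:\;\mu(V^{[r]}_{[r_{j-1},r_j[})>\mu_{jk}\}$; if $A_{jk}\ne\emptyset$ put $r_{j,k+1}=\min(A_{jk})$ and $\mu_{j,k+1}=\mu(V^{[r_{j,k+1}]}_{[r_{j-1},r_j[})$; if $A_{jk}=\emptyset$ stop and let $M_j(V)=\begin{pmatrix} r_{j1}&\cdots&r_{jk}\\ \mu_{j1}&\cdots&\mu_{jk}\end{pmatrix}$. The measure sequence of $V$ is $\mathbb{M}(V)=(M_1(V),\dots,M_h(V))$. For an arbitrary $n$-SLTM $T\nsim 0_n$, $\mathbb{M}(T):=\mathbb{M}(V)$ where $V$ is any matrix in $2$-REF with $T\sim V$ (such $V$ exists and the value does not depend on the choice). *)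

(* Defs.v *)
From HB Require Import structures.
From mathcomp Require Import all_boot all_order all_algebra.
From mathcomp Require Import boolp classical_sets.
From mathcomp.multinomials Require Import mpoly.

Set Implicit Arguments.
Unset Strict Implicit.
Unset Printing Implicit Defensive.

Import GRing.Theory.

Local Open Scope ring_scope.
Local Open Scope quotient_scope.

Section Algebra.
Variables (F : fieldType) (n : nat).
Implicit Type T : 'M[F]_n.

Definition is_sltm T : Prop := forall i j : 'I_n, (i <= j)%N -> T i j = 0.

(* With 'I_n counting from 0, the least index gives the relation 'X_i ^+ 2. *)
Definition sltm_rel T (i : 'I_n) : {mpoly F[n]} :=
  'X_i ^+ 2 - \sum_(j < n | (j < i)%N) T i j *: ('X_j * 'X_i).

Definition sltm_ideal T : {pred {mpoly F[n]}} :=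
  fun p => `[< exists c : 'I_n -> {mpoly F[n]},
                 p = \sum_(i < n) c i * sltm_rel T i >].

Lemma sltm_rel_at0 T i : (sltm_rel T i).@[fun=> 0] = 0.
Proof.
rewrite /sltm_rel rmorphB rmorphXn /= mevalXU expr2 mul0r sub0r.
rewrite (raddf_sum (meval (fun=> 0))) big1 ?oppr0 // => j _ /=.
by rewrite mevalZ rmorphM /= !mevalXU !mulr0.
Qed.

Lemma sltm_idealr_closed T : idealr_closed (sltm_ideal T).
Proof.
split.
- apply/asboolP; exists (fun=> 0).
  by rewrite big1 // => i _; rewrite mul0r.
- apply/negP => /asboolP[c].
  move=> /(congr1 (meval (fun=> 0))); rewrite rmorph1 (raddf_sum (meval (fun=> 0))) big1.
    by apply/eqP; rewrite oner_eq0.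
  by move=> i _ /=; rewrite rmorphM /= sltm_rel_at0 mulr0.
- move=> a u v /asboolP[c ->] /asboolP[d ->].
  apply/asboolP; exists (fun i => a * c i + d i).
  rewrite big_distrr /= -big_split /=.
  by apply: eq_bigr => i _; rewrite mulrDl mulrA.
Qed.

HB.instance Definition _ T :=
  isIdealr.Build {mpoly F[n]} (sltm_ideal T) (sltm_idealr_closed T).

Definition sltm_alg T := {ideal_quot (sltm_ideal T)}.

HB.instance Definition _ T := GRing.ComNzRing.on (sltm_alg T).

Definition sltm_pi T (p : {mpoly F[n]}) : sltm_alg T :=
  \pi_({ideal_quot (sltm_ideal T)}) p.

Fact sltm_pi_zmod_morphism T : zmod_morphism (@sltm_pi T).
Proof. exact: rmorphB. Qed.

Fact sltm_pi_monoid_morphism T : monoid_morphism (@sltm_pi T).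
Proof. by split; [exact: rmorph1 | exact: rmorphM]. Qed.

HB.instance Definition _ T := GRing.isZmodMorphism.Build
  {mpoly F[n]} (sltm_alg T) (@sltm_pi T) (@sltm_pi_zmod_morphism T).
HB.instance Definition _ T := GRing.isMonoidMorphism.Build
  {mpoly F[n]} (sltm_alg T) (@sltm_pi T) (@sltm_pi_monoid_morphism T).

Definition sltm_scale T (a : F) (x : sltm_alg T) : sltm_alg T :=
  sltm_pi T a%:MP * x.

Fact sltm_scaleA T a b (x : sltm_alg T) :
  sltm_scale a (sltm_scale b x) = sltm_scale (a * b) x.
Proof. by rewrite /sltm_scale mulrA -rmorphM /= mpolyCM. Qed.

Fact sltm_scale1 T : left_id 1 (@sltm_scale T).
Proof. by move=> x; rewrite /sltm_scale mpolyC1 rmorph1 mul1r. Qed.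

Fact sltm_scaleDr T : right_distributive (@sltm_scale T) +%R.
Proof. by move=> a x y; rewrite /sltm_scale mulrDr. Qed.

Fact sltm_scaleDl T (x : sltm_alg T) :
  {morph (@sltm_scale T)^~ x : a b / a + b}.
Proof. by move=> a b; rewrite /sltm_scale mpolyCD rmorphD mulrDl. Qed.

HB.instance Definition _ T := GRing.Zmodule_isLmodule.Build F (sltm_alg T)
  (@sltm_scaleA T) (@sltm_scale1 T) (@sltm_scaleDr T) (@sltm_scaleDl T).

Fact sltm_scaleAl T (a : F) (x y : sltm_alg T) : a *: (x * y) = (a *: x) * y.
Proof. exact: mulrA. Qed.

HB.instance Definition _ T :=
  GRing.Lmodule_isLalgebra.Build F (sltm_alg T) (@sltm_scaleAl T).
HB.instance Definition _ T := GRing.Lalgebra_isComAlgebra.Build F (sltm_alg T).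

Fact sltm_pi_scalable T : scalable (@sltm_pi T).
Proof. by move=> a p; rewrite -mul_mpolyC rmorphM. Qed.

HB.instance Definition _ T := GRing.isScalable.Build F
  {mpoly F[n]} (sltm_alg T) *:%R (@sltm_pi T) (@sltm_pi_scalable T).

(* Each generator X_i = sltm_pi T 'X_i has degree 2.                           *)
Definition sltm_homog T (d : nat) (x : sltm_alg T) : Prop :=
  exists2 p : {mpoly F[n]},
    {in msupp p, forall m : 'X_{1..n}, (2 * mdeg m)%N = d} & sltm_pi T p = x.

Definition sltm_equiv T S : Prop :=
  exists f : {lrmorphism sltm_alg T -> sltm_alg S},
    bijective f /\
    forall d (x : sltm_alg T), sltm_homog d x -> sltm_homog d (f x).

End Algebra.

Section EchelonForms.
Variables (F : fieldType) (n : nat).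
Implicit Types T S V : 'M[F]_n.

(* Rows and columns are numbered from 1, as wall entries and leader columns    *)
(* (0 for a zero row) are; the value is 0 outside [1, n] x [1, n].             *)
Definition entry T (r c : nat) : F :=
  \sum_(i < n | i.+1 == r) \sum_(j < n | j.+1 == c) T i j.

Lemma entryE T (i j : 'I_n) : entry T i.+1 j.+1 = T i j.
Proof.
by rewrite /entry (big_pred1 i) ?(big_pred1 j) // => k; rewrite eqSS.
Qed.

Definition row_nonzero T (r : nat) : bool :=
  has (fun c => entry T r c != 0) (index_iota 1 n.+1).

Definition leader_col T (r : nat) : nat :=
  \max_(1 <= c < n.+1 | entry T r c != 0) c.

Definition leader_position T (r c : nat) : Prop :=
  [/\ (1 <= r <= n)%N, row_nonzero T r & c = leader_col T r].

Definition Delta (a : F) T (i j k : nat) : F :=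
  a * entry T k i + entry T k j * entry T j i.

Definition zero_rows_above T : Prop :=
  forall r s : nat, (1 <= r <= n)%N -> (1 <= s <= n)%N ->
    ~~ row_nonzero T r -> row_nonzero T s -> (r < s)%N.

Definition leaders_irreducible T : Prop :=
  forall r c : nat, leader_position T r c ->
    (1 < c)%N /\ exists2 i : nat, (1 <= i < c)%N & Delta 2 T i c r != 0.

Definition is_1REF T : Prop :=
  is_sltm T /\
  (T = 0 \/
   [/\ zero_rows_above T, leaders_irreducible T
     & forall r c c' : nat,
         leader_position T r c -> leader_position T r.+1 c' -> (c <= c')%N]).

(* The chain r, head (A r), head (A (head (A r))), ... until A is empty. In    *)
(* both uses below A r lists, in increasing order, elements of ]r, n], so      *)
(* that fuel n is never exhausted.                                             *)
Fixpoint min_chain (A : nat -> seq nat) (fuel r : nat) : seq nat :=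
  r :: if fuel is k.+1 then if A r is s :: _ then min_chain A k s else [::]
       else [::].

Definition wall_1REF T : seq nat :=
  if [seq r <- index_iota 1 n.+1 | row_nonzero T r] is r1 :: _ then
    min_chain
      (fun r => [seq s <- index_iota r.+1 n.+1 | (r <= leader_col T s)%N]) n r1
  else [:: 0%N].

(* W(T) is well defined, with value w.                                         *)
Definition has_wall T (w : seq nat) : Prop :=
  (exists2 S, is_1REF S & sltm_equiv T S) /\
  forall S, is_1REF S -> sltm_equiv T S -> wall_1REF S = w.

Definition wall T : seq nat := xget [::] (has_wall T).

(* r_0 = 1, r_1, ..., r_h, r_(h+1) = n + 1                                     *)
Definition wall_at T (j : nat) : nat := nth n.+1 (1%N :: wall T) j.

Definition mu T (r a b : nat) : nat :=
  count (fun c => entry T r c != 0) (index_iota a b).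

Definition mu_wall T (j r : nat) : nat :=
  mu T r (wall_at T j.-1) (wall_at T j).

Definition is_2REF T : Prop :=
  is_sltm T /\
  (T = 0 \/
   ~ sltm_equiv T 0 /\
   [/\ count (fun r => ~~ row_nonzero T r) (index_iota 1 n.+1)
         = (wall_at T 1 - 1)%N /\ zero_rows_above T,
       leaders_irreducible T /\
       (forall j r : nat, (1 <= j <= size (wall T))%N ->
          (wall_at T j <= r < wall_at T j.+1)%N ->
          (wall_at T j.-1 <= leader_col T r < wall_at T j)%N)
     & forall j r : nat, (1 <= j <= size (wall T))%N ->
         (wall_at T j <= r < wall_at T j.+1 - 1)%N ->
         (mu_wall T j r <= mu_wall T j r.+1)%N]).

(* M_j is the list of its columns (r_jk, mu_jk).                               *)
Definition measure_block V (j : nat) : seq (nat * nat) :=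
  [seq (r, mu_wall V j r) |
     r <- min_chain
            (fun r => [seq s <- index_iota r.+1 (wall_at V j.+1)
                         | (mu_wall V j r < mu_wall V j s)%N])
            n (wall_at V j)].

Definition measure_2REF V : seq (seq (nat * nat)) :=
  [seq measure_block V j | j <- index_iota 1 (size (wall V)).+1].

(* M(T) is well defined, with value m.                                         *)
Definition has_measure T (m : seq (seq (nat * nat))) : Prop :=
  (exists2 V, is_2REF V & sltm_equiv T V) /\
  forall V, is_2REF V -> sltm_equiv T V -> measure_2REF V = m.

Definition measure_seq T : seq (seq (nat * nat)) := xget [::] (has_measure T).

End EchelonForms.

(* Main.v *)
(* Only products of degree one elements matter: T ~ S holds exactly when the
   degree one part of A(S) has a basis Y_i with Y_i^2 = sum_(j<i) t_ij Y_j Y_i.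
   Define subspaces E_0 = 0 and E_(j+1) = span {v : v (v - u) = 0, u in E_j}.
   In a 1-REF or 2-REF basis, E_j is spanned by the X_i with i < r_j; as the E_j
   are intrinsic, so is the wall.  If Y is another such basis and Y_r lies in
   E_(j+1) but not in E_j, then Y_r is, modulo E_j, a multiple of a single X_m;
   this matches the rows of the two matrices within each block.  If
   Y_r^2 = u Y_r, the form u and the multiple s of row m have the same square,
   which modulo E_(j-1) reads u_i u_k = s_i s_k for i <> k, so u and s have
   equally many nonzero coefficients there.  Both sequences of measures in a
   block are therefore permutations of each other, and they are sorted. *)

Require Import Defs.
From HB Require Import structures.
From mathcomp Require Import all_fingroup all_boot all_order all_algebra.
From mathcomp Require Import boolp classical_sets.
From mathcomp Require Import zify ring.
From mathcomp.multinomials Require Import mpoly.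

Set Implicit Arguments.
Unset Strict Implicit.
Unset Printing Implicit Defensive.

Import GRing.Theory.

Local Open Scope ring_scope.

(** If [c] is the leader column of row [r] and [i < c], the coefficient of [X_i X_c] in [L_r^2] is
    [t_rc] times [Delta^(2)_(i,c,r)]. Irreducibility thus says that [X_c] survives in [L_r^2], and
    this is why a square detects the level of a leader. Products of coefficients at distinct indices
    determine a support only when it has at least two elements; with a single nonzero coefficient
    they all vanish. So each row of positive level must be known to have an entry in the level just
    below, which is part of [leveled]. Both reduced forms are translated into [leveled], so that a
    single comparison of bases yields the uniqueness of walls and of measures. The values [wall] and
    [measure_seq] are picked by choice, so both forms must also be shown to exist. The second is
    obtained from the first by permuting generators inside levels; this may move leaders, hence
    irreducibility has to be recovered from the intrinsic spaces [E_j]. *)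

(** * Products of degree one elements and changes of basis *)

Section QuadraticProduct.
Variables (F : fieldType) (n : nat).
Implicit Types (S T U P : 'M[F]_n) (x y z : 'rV[F]_n).

(* The coefficient of X_a X_b, a < b, in the product of x and y in A(S). *)
Definition qform S x y (a b : 'I_n) : F :=
  x 0 a * y 0 b + x 0 b * y 0 a + S b a * (x 0 b * y 0 b).

(** Stands for [x y = 0] in A(S), as [sltm_pi_linform2] confirms when 2 is nonzero. *)
Definition orth S x y : Prop :=
  forall a b : 'I_n, (a < b)%N -> qform S x y a b = 0.

Lemma qformC S x y a b : qform S x y a b = qform S y x a b.
Proof. by rewrite /qform; ring. Qed.

Lemma qformDl S x y z a b :
  qform S (x + y) z a b = qform S x z a b + qform S y z a b.
Proof. by rewrite /qform !mxE; ring. Qed.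

Lemma qformZl S c x y a b : qform S (c *: x) y a b = c * qform S x y a b.
Proof. by rewrite /qform !mxE; ring. Qed.

Lemma qform_suml S (I : finType) (c : I -> F) (v : I -> 'rV_n) y a b :
  qform S (\sum_i c i *: v i) y a b = \sum_i c i * qform S (v i) y a b.
Proof.
apply: (big_ind2 (fun u t => qform S u y a b = t)) => [|u1 t1 u2 t2 <- <-|i _].
- by rewrite /qform !mxE; ring.
- exact: qformDl.
- exact: qformZl.
Qed.

Lemma sum_triangle (V : zmodType) (f : 'I_n -> 'I_n -> V) :
  \sum_k \sum_l f k l =
    \sum_l f l l + \sum_(l < n) \sum_(k < n | (k < l)%N) (f k l + f l k).
Proof.
have split3 (l : 'I_n) : \sum_k f k l = f l l + (\sum_(k < n | (k < l)%N) f k l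
    + \sum_(k < n | (l < k)%N) f k l).
  rewrite (bigD1 l) //=; congr (_ + _).
  rewrite (bigID (fun k : 'I_n => (k < l)%N)) /=; congr (_ + _);
    apply: eq_bigl => k; rewrite -(inj_eq val_inj) /=; lia.
rewrite exchange_big /= (eq_bigr _ (fun l _ => split3 l)) !big_split /=.
congr (_ + _); under [RHS]eq_bigr => l _ do rewrite big_split /=.
rewrite big_split /=; congr (_ + _).
rewrite (exchange_big_dep predT) //=.
Qed.

(* In any commutative algebra where the relations of T hold, a product of two
   degree one elements is computed from the mixed products alone. *)
Lemma quad_expand (V : lmodType F) T (G : 'I_n -> 'I_n -> V) x y :
    (forall k l, G k l = G l k) ->
    (forall k, G k k = \sum_(l < n | (l < k)%N) T k l *: G l k) ->
  \sum_(k < n) \sum_(l < n) (x 0 k * y 0 l) *: G k l =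
    \sum_(l < n) \sum_(k < n | (k < l)%N) qform T x y k l *: G k l.
Proof.
move=> Gsym Gdiag; rewrite sum_triangle -big_split /=; apply: eq_bigr => l _.
rewrite Gdiag scaler_sumr -big_split /=; apply: eq_bigr => k _.
by rewrite (Gsym l k) scalerA -!scalerDl /qform; congr (_ *: _); ring.
Qed.

(* The rows of P are a basis of the degree one part of A(S) satisfying the
   relations of A(T). *)
Definition presents T S P : Prop :=
  P \in unitmx /\ forall i, orth S (row i P) (row i P - row i T *m P).

Lemma presents_diag T S P (a b i : 'I_n) :
    is_sltm T -> presents T S P -> (a < b)%N ->
  qform S (row i P) (row i P) a b =
  \sum_(l < n | (l < i)%N) T i l * qform S (row l P) (row i P) a b.
Proof.
move=> Tlow [_ PS] ab; have := PS i a b ab.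
rewrite qformC qformDl -scaleN1r qformZl mulN1r => /eqP.
rewrite subr_eq0 => /eqP ->; rewrite mulmx_sum_row qform_suml.
rewrite [RHS]big_mkcond /=; apply: eq_bigr => l _; rewrite mxE.
by case: ltnP => // il; rewrite Tlow ?mul0r.
Qed.

Lemma qform_mulmx S P x y a b : qform S (x *m P) (y *m P) a b =
  \sum_(k < n) \sum_(l < n) (x 0 k * y 0 l) * qform S (row k P) (row l P) a b.
Proof.
rewrite [x *m P]mulmx_sum_row qform_suml; apply: eq_bigr => k _.
rewrite qformC mulmx_sum_row qform_suml mulr_sumr; apply: eq_bigr => l _.
by rewrite mulrA qformC.
Qed.

(** For fixed [a < b], the coefficients of the products [Y_k Y_l] at [X_a X_b] satisfy the relations
    of T, so [quad_expand] applies to them with the weights [qform T x y], which vanish. *)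
Lemma presents_orth T S P x y : is_sltm T -> presents T S P ->
  orth T x y -> orth S (x *m P) (y *m P).
Proof.
move=> Tlow PTS xy a b ab; rewrite qform_mulmx.
pose G k l : F^o := qform S (row k P) (row l P) a b.
have /= -> := @quad_expand F^o T G x y.
- by rewrite big1 // => l _; rewrite big1 // => k kl; rewrite xy // scale0r.
- by move=> k l; apply: qformC.
- by move=> k; rewrite /G (presents_diag _ Tlow PTS).
Qed.

Lemma presents_refl T : is_sltm T -> presents T T 1%:M.
Proof.
move=> Tlow; split=> [|i a b ab]; first exact: unitmx1.
rewrite mulmx1 /qform row1 !mxE eqxx /=.
have [ai|ai] := eqVneq a i; have [bi|bi] := eqVneq b i.
- by move: ab; rewrite ai bi ltnn.
- by rewrite -ai (Tlow a b) ?(ltnW ab) //=; ring.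
- by rewrite -bi (Tlow b b) //=; ring.
- by rewrite /=; ring.
Qed.

Lemma presents_trans T S U P Q : is_sltm S ->
  presents T S P -> presents S U Q -> presents T U (P *m Q).
Proof.
move=> Slow [Pu PS] SUQ; split; first by rewrite unitmx_mul Pu SUQ.1.
move=> i; rewrite -row_mul -[row i (P *m Q)]/(row i _) row_mul.
by rewrite row_mul mulmxA -mulmxBl; apply: presents_orth (PS i).
Qed.

(** Polarization: [symmx (diag_mx v *m (1%:M - T))] is the matrix of the polar form of the
    combination of relations [sum_i v_i X_i (X_i - L_i)]. *)
Definition symmx (A : 'M[F]_n) : 'M[F]_n := A + A^T.

Lemma symmx_congr P A : symmx (P^T *m A *m P) = P^T *m symmx A *m P.
Proof. by rewrite /symmx !trmx_mul trmxK mulmxDr mulmxDl !mulmxA. Qed.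

Lemma symmx_diagE T (v : 'rV_n) (a b : 'I_n) :
  symmx (diag_mx v *m (1%:M - T)) a b =
  v 0 a * ((a == b)%:R - T a b) + v 0 b * ((a == b)%:R - T b a).
Proof. by rewrite /symmx mul_diag_mx !mxE [b == a]eq_sym. Qed.

Lemma sltm_diag T (i : 'I_n) : is_sltm T -> T i i = 0.
Proof. by move=> ->. Qed.

(** Each [Y_i (Y_i - L_i(Y))] vanishes in A(S), so its mixed coefficients are determined by its
    coefficients at the squares [X_k^2]: it is the combination of the relations of S with exactly
    these coefficients. *)
Lemma presents_symmx T S P (v : 'rV_n) : is_sltm S -> presents T S P ->
  P^T *m symmx (diag_mx v *m (1%:M - T)) *m P =
  symmx (diag_mx (v *m \matrix_(i, k) (P i k * ((1%:M - T) *m P) i k))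
         *m (1%:M - S)).
Proof.
move=> Slow [Pu PS]; set Z := (1%:M - T) *m P.
rewrite -symmx_congr -!mulmxA -/Z.
have rowZ i k : Z i k = (row i P - row i T *m P) 0 k.
  by rewrite /Z mulmxBl mul1mx -row_mul !mxE.
clearbody Z.
have rowPE i k : row i P 0 k = P i k by rewrite mxE.
have LHS a b : symmx (P^T *m (diag_mx v *m Z)) a b =
    \sum_i v 0 i * (P i a * Z i b + P i b * Z i a).
  rewrite /symmx mul_diag_mx !mxE -big_split /=; apply: eq_bigr => i _.
  by rewrite !mxE; ring.
have main (a b : 'I_n) : (a <= b)%N -> symmx (P^T *m (diag_mx v *m Z)) a b =
  symmx (diag_mx (v *m \matrix_(i, k) (P i k * Z i k)) *m (1%:M - S)) a b.
  move=> ab; rewrite LHS symmx_diagE !mxE !mulr_suml -big_split /=.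
  apply: eq_bigr => i _; rewrite !mxE (Slow a b) //.
  move: ab; rewrite leq_eqVlt => /orP[/eqP/val_inj <-|ab].
    by rewrite eqxx (Slow a a) // mulr1n; ring.
  have -> : (a == b) = false by apply/eqP => E; rewrite E ltnn in ab.
  have := PS i a b ab; rewrite /qform -!rowZ !rowPE => /eqP.
  by rewrite addr_eq0 => /eqP ->; rewrite mulr0n; ring.
apply/matrixP => a b; have [/main //|/ltnW/main] := leqP a b.
have symE (A : 'M[F]_n) c d : symmx A c d = symmx A d c.
  by rewrite !mxE addrC.
by rewrite symE => ->; rewrite symE.
Qed.

(* Sending the relations of T into those of S, an invertible change of
   variables does so bijectively: both span spaces of dimension n. *)
Lemma presents_sym T S P : 2 != 0 :> F -> is_sltm T -> is_sltm S ->
  presents T S P -> presents S T (invmx P).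
Proof.
move=> two_neq0 Tlow Slow PTS; have Pu := PTS.1.
have tPu : P^T \in unitmx by rewrite unitmx_tr.
(* [Q] maps the coefficients of a combination of relations of T to those of its image among the
   relations of S. It is injective because the polar form has diagonal entries [2 v_i]. *)
pose Q := \matrix_(i, k) (P i k * ((1%:M - T) *m P) i k).
have Qu : Q \in unitmx.
  rewrite -row_free_unit; apply: inj_row_free => v vQ.
  have := presents_symmx v Slow PTS; rewrite -/Q vQ.
  have -> : diag_mx (0 : 'rV[F]_n) = 0 by exact: raddf0.
  rewrite mul0mx /symmx trmx0 addr0 -/(symmx _) => /(canRL (mulmxK Pu)).
  rewrite mul0mx => /(canRL (mulKmx tPu)); rewrite mulmx0 => /matrixP sym0.
  apply/rowP => i; have := sym0 i i.
  rewrite symmx_diagE (sltm_diag _ Tlow) eqxx !mxE subr0 mulr1 -mulr2n.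
  by move/eqP; rewrite -mulr_natr mulf_eq0 (negPf two_neq0) orbF => /eqP.
split; first by rewrite unitmx_inv.
move=> k a b ab; set y := row k _; set z := _ - _.
(* The combination of relations of T whose image is the [k]-th relation of S; in the inverse
   coordinates that relation is the product of [y] and [z]. *)
pose v := row k (invmx Q).
have symE : symmx (diag_mx v *m (1%:M - T)) = symmx (y^T *m z).
  have := presents_symmx v Slow PTS; rewrite -/Q /v -row_mul mulVmx //.
  move/(canRL (mulmxK Pu))/(canRL (mulKmx tPu)); rewrite mulmxA => ->.
  rewrite -trmx_inv -symmx_congr; congr symmx.
  have -> : diag_mx (row k 1%:M) = (delta_mx 0 k : 'rV[F]_n)^T *m delta_mx 0 k.
    rewrite trmx_delta mul_delta_mx row1; apply/matrixP => i j; rewrite !mxE.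
    rewrite eqxx /=; case: (eqVneq i j) => [->|ij]; first by rewrite andbb.
    by case: (eqVneq i k) => //= <-; rewrite eq_sym (negPf ij).
  rewrite -!mulmxA mulmxA -trmx_mul -rowE -/y; congr (_ *m _).
    by rewrite -rowE.
  by rewrite mulmxBl mul1mx raddfB /= row_mul.
have symab := congr1 (fun A : 'M_n => A a b) symE.
have symbb := congr1 (fun A : 'M_n => A b b) symE.
have symyz (p q : 'rV[F]_n) c d :
    symmx (p^T *m q) c d = p 0 c * q 0 d + p 0 d * q 0 c.
  by rewrite /symmx !mxE !big_ord1 !mxE.
move: symab symbb; rewrite !symmx_diagE !symyz (Tlow a b) ?(ltnW ab) //.
rewrite (Tlow b b) // eqxx /=.
have -> : (a == b) = false by apply/eqP => E; rewrite E ltnn in ab.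
rewrite /qform mulr1n mulr0n !subr0 !mulr1 => symab symbb.
have vb : v 0 b = y 0 b * z 0 b.
  by apply: (mulfI two_neq0); rewrite !mulr_natl !mulr2n.
by move: symab; rewrite vb => symab; rewrite -symab /=; ring.
Qed.

End QuadraticProduct.

(** * Degree-preserving isomorphisms as linear changes of generators *)

Section DegreeTwo.
Variables (F : fieldType) (n : nat).
Implicit Types (S T P Q : 'M[F]_n) (x y : 'rV[F]_n) (p q : {mpoly F[n]}).

Definition linform x : {mpoly F[n]} := \sum_j x 0 j *: 'X_j.

Lemma linform0 : linform 0 = 0.
Proof. by rewrite /linform big1 // => j _; rewrite mxE scale0r. Qed.

Lemma linformB x y : linform (x - y) = linform x - linform y.
Proof.
by rewrite /linform -sumrB; apply: eq_bigr => j _; rewrite !mxE scalerBl.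
Qed.

Lemma linform_delta i : linform (delta_mx 0 i) = 'X_i.
Proof.
rewrite /linform (bigD1 i) //= big1 ?addr0 => [|j ji].
  by rewrite mxE !eqxx scale1r.
by rewrite mxE eqxx (negPf ji) scale0r.
Qed.

Lemma linform_at0 x : (linform x).@[fun=> 0] = 0.
Proof.
rewrite (raddf_sum (meval _)) big1 // => j _ /=.
by rewrite mevalZ mevalXU mulr0.
Qed.

Lemma mderiv_linform a x : (linform x)^`M(a) = (x 0 a)%:MP.
Proof.
rewrite (raddf_sum (mderiv a)) (bigD1 a) //= big1 ?addr0 => [|j ja].
  rewrite mderivZ mderivX mnmE eqxx.
  have -> : (U_(a) - U_(a) = 0 :> 'X_{1..n})%MM.
    by apply/mnmP => k; rewrite !mnmE subnn.
  by rewrite mpolyX0 scale1r -mul_mpolyC mulr1.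
by rewrite mderivZ mderivX mnmE (negPf ja) scale0r scaler0.
Qed.

Lemma mderiv_linform2 a q x y :
  ((q * (linform x * linform y))^`M(a)).@[fun=> 0] = 0.
Proof.
by rewrite !mderivM !mderiv_linform !(mevalD, mevalM) !linform_at0; ring.
Qed.

(** Second derivatives at the origin see only the degree two part, so a multiplier [q] contributes
    its constant term alone. This makes membership in the ideal testable. *)
Lemma mderiv2_linform2 a b q x y :
  ((q * (linform x * linform y))^`M(a)^`M(b)).@[fun=> 0] =
  q.@[fun=> 0] * (x 0 a * y 0 b + x 0 b * y 0 a).
Proof.
rewrite !(mderivM, mderivD, mderiv_linform, mderivC).
by rewrite !(mevalD, mevalM, mevalC, linform_at0, meval0); ring.
Qed.

Lemma sltm_relE T i : is_sltm T ->
  sltm_rel T i = linform (delta_mx 0 i) * linform (delta_mx 0 i - row i T).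
Proof.
move=> Tlow; rewrite linformB mulrBr !linform_delta -expr2; congr (_ - _).
rewrite /linform mulr_sumr big_mkcond /=; apply: eq_bigr => j _.
by rewrite mxE -scalerAr [X in _ *: X]mulrC; case: ltnP => // ji;
  rewrite Tlow ?scale0r.
Qed.

Lemma sltm_pi_eq0 T p : sltm_pi T p = 0 <->
  exists c : 'I_n -> {mpoly F[n]}, p = \sum_(i < n) c i * sltm_rel T i.
Proof.
have := Quotient.idealrBE (sltm_ideal T) p 0.
rewrite subr0 -/(sltm_pi T p) -/(sltm_pi T 0) rmorph0 => piE.
split=> [/eqP|pI]; first by rewrite -piE => /asboolP.
by apply/eqP; rewrite -piE; apply/asboolP.
Qed.

Lemma sltm_pi_rel T i : sltm_pi T (sltm_rel T i) = 0.
Proof.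
apply/sltm_pi_eq0; exists (fun j => (j == i)%:R).
rewrite (bigD1 i) //= eqxx mul1r big1 ?addr0 // => j /negPf ->.
by rewrite mul0r.
Qed.

Section Bridge.
Hypothesis two_neq0 : 2 != 0 :> F.

(** The relations have neither constant nor linear part, so first derivatives at the origin kill the
    whole ideal. *)
Lemma sltm_pi_linform T x : is_sltm T -> sltm_pi T (linform x) = 0 -> x = 0.
Proof.
move=> Tlow /sltm_pi_eq0[c xE]; apply/rowP => a; rewrite mxE.
have := congr1 (fun p => (p^`M(a)).@[fun=> 0]) xE.
rewrite /= mderiv_linform mevalC => ->.
rewrite (raddf_sum (mderiv a)) (raddf_sum (meval _)) big1 // => i _ /=.
by rewrite (sltm_relE _ Tlow) mderiv_linform2.
Qed.

Lemma sltm_pi_linform2 T x y : is_sltm T ->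
  sltm_pi T (linform x * linform y) = 0 <-> orth T x y.
Proof.
move=> Tlow; split.
  move=> /sltm_pi_eq0[c xyE] a b ab.
  (* Up to the factor 2, this is the coefficient of X_a X_b in A(T). *)
  pose psi p := 2 * (p^`M(a)^`M(b)).@[fun=> 0]
                + T b a * (p^`M(b)^`M(b)).@[fun=> 0].
  have psiM q u v : psi (q * (linform u * linform v)) =
      2 * q.@[fun=> 0] * qform T u v a b.
    by rewrite /psi !mderiv2_linform2 /qform; ring.
  have psi_sum (f : 'I_n -> {mpoly F[n]}) : psi (\sum_i f i) = \sum_i psi (f i).
    have D d (g : 'I_n -> {mpoly F[n]}) :
      (\sum_i g i)^`M(d) = \sum_i (g i)^`M(d) by exact: raddf_sum.
    rewrite /psi !D !(raddf_sum (meval _)) !mulr_sumr.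
    by rewrite [RHS]big_split.
  have psi0 : psi (linform x * linform y) = 0.
    rewrite xyE psi_sum big1 // => i _; rewrite (sltm_relE _ Tlow) psiM.
    have /(_ i a b ab) := (presents_refl Tlow).2.
    by rewrite mulmx1 row1 => ->; rewrite mulr0.
  move: psi0; rewrite -[X in psi X]mul1r psiM meval1 mulr1 => /eqP.
  by rewrite mulf_eq0 (negPf two_neq0) => /eqP.
move=> xy; pose G k l := sltm_pi T ('X_k * 'X_l).
have -> : sltm_pi T (linform x * linform y) =
    \sum_k \sum_l (x 0 k * y 0 l) *: G k l.
  rewrite /linform mulr_suml rmorph_sum; apply: eq_bigr => k _ /=.
  rewrite mulr_sumr rmorph_sum; apply: eq_bigr => l _ /=.
  by rewrite -scalerAl -scalerAr scalerA linearZ.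
rewrite (@quad_expand _ _ _ T).
- by rewrite big1 // => l _; rewrite big1 // => k kl; rewrite xy // scale0r.
- by move=> k l; rewrite /G mulrC.
- move=> k; have relk := sltm_pi_rel T k.
  move: relk; rewrite /sltm_rel rmorphB rmorph_sum /= => /eqP.
  rewrite subr_eq0 /G -expr2 => /eqP ->; apply: eq_bigr => l _.
  by rewrite linearZ.
Qed.

Lemma homog1_linform p : {in msupp p, forall m : 'X_{1..n}, (2 * mdeg m)%N = 2%N} ->
  p = linform (\row_j p@_U_(j)).
Proof.
move=> p1; apply/mpolyP => m; rewrite /linform raddf_sum /=.
have [/existsP[i /eqP ->]|mN1] := boolP [exists i : 'I_n, m == U_(i)%MM].
  rewrite (bigD1 i) //= big1 ?addr0 => [|j ji].
    by rewrite mcoeffZ mcoeffXU eqxx mulr1 mxE.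
  by rewrite mcoeffZ mcoeffXU (negPf ji) mulr0.
rewrite big1 => [|j _].
  apply/eqP; rewrite mcoeff_eq0; apply: contra mN1 => /p1 m1.
  by rewrite -mdeg_eq1; apply/eqP; lia.
rewrite mcoeffZ mcoeffX; case: eqP => [jm|]; last by rewrite mulr0.
by case/negP: mN1; apply/existsP; exists j; rewrite jm.
Qed.

(** Elements of degree 2 are classes of linear forms, so the images of the [X_i] give the rows of
    [P]; injectivity of the isomorphism makes [P] invertible. *)
Lemma sltm_equiv_presents T S : is_sltm T -> is_sltm S ->
  sltm_equiv T S -> exists P, presents T S P.
Proof.
move=> Tlow Slow [f [[g fK gK] fhom]].
have fX i : exists x, f (sltm_pi T 'X_i) = sltm_pi S (linform x).
  have /fhom[p /homog1_linform pE <-] : sltm_homog 2 (sltm_pi T 'X_i).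
    exists 'X_i => // m; rewrite msuppX inE => /eqP ->.
    by rewrite mdeg1.
  by eexists; rewrite {1}pE.
have [h hE] := choice fX; pose P : 'M[F]_n := \matrix_i h i; exists P.
have flin x : f (sltm_pi T (linform x)) = sltm_pi S (linform (x *m P)).
  rewrite /linform [in LHS]raddf_sum [in LHS]raddf_sum /=.
  have -> : \sum_j (x *m P) 0 j *: 'X_j =
      \sum_i x 0 i *: linform (h i) :> {mpoly F[n]}.
    under [RHS]eq_bigr => i _ do rewrite scaler_sumr.
    rewrite exchange_big /=; apply: eq_bigr => j _.
    rewrite mxE scaler_suml; apply: eq_bigr => i _.
    by rewrite scalerA mxE.
  rewrite raddf_sum /=; apply: eq_bigr => i _.
  by rewrite !linearZ /= hE.
split.
  rewrite -row_free_unit; apply: inj_row_free => v vP0.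
  apply: (sltm_pi_linform Tlow); apply: (can_inj fK).
  by rewrite flin vP0 linform0 !rmorph0.
move=> i; apply/(sltm_pi_linform2 _ _ Slow).
have -> : row i P - row i T *m P = (delta_mx 0 i - row i T) *m P.
  by rewrite mulmxBl -rowE.
rewrite [row i P]rowE rmorphM /= -!flin -!rmorphM /= -(sltm_relE _ Tlow).
by rewrite sltm_pi_rel rmorph0.
Qed.

Definition lin_subst P p : {mpoly F[n]} :=
  p \mPo [tuple linform (row i P) | i < n].

Fact lin_subst_zmod_morphism P : zmod_morphism (lin_subst P).
Proof. by move=> p q; rewrite /lin_subst raddfB. Qed.

Fact lin_subst_monoid_morphism P : monoid_morphism (lin_subst P).
Proof. by split=> [|p q]; rewrite /lin_subst (rmorph1, rmorphM). Qed.

Fact lin_subst_scalable P : scalable (lin_subst P).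
Proof. by move=> a p; rewrite /lin_subst comp_mpolyZ. Qed.

HB.instance Definition _ P := GRing.isZmodMorphism.Build
  {mpoly F[n]} {mpoly F[n]} (lin_subst P) (@lin_subst_zmod_morphism P).
HB.instance Definition _ P := GRing.isMonoidMorphism.Build
  {mpoly F[n]} {mpoly F[n]} (lin_subst P) (@lin_subst_monoid_morphism P).
HB.instance Definition _ P := GRing.isScalable.Build F
  {mpoly F[n]} {mpoly F[n]} *:%R (lin_subst P) (@lin_subst_scalable P).

Lemma lin_substX P i : lin_subst P 'X_i = linform (row i P).
Proof. by rewrite /lin_subst comp_mpolyXU -tnth_nth tnth_mktuple. Qed.

Lemma lin_subst_linform P x : lin_subst P (linform x) = linform (x *m P).
Proof.
rewrite {1}/linform raddf_sum /=.
under eq_bigr => i _ do rewrite linearZ /= lin_substX /linform scaler_sumr.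
rewrite exchange_big /=; apply: eq_bigr => j _.
rewrite mxE scaler_suml; apply: eq_bigr => i _.
by rewrite scalerA mxE.
Qed.

Lemma lin_subst_comp P Q p : lin_subst Q (lin_subst P p) = lin_subst (P *m Q) p.
Proof.
elim/mpolyind: p => [|c m p _ _ IHp]; first by rewrite !rmorph0.
rewrite !rmorphD /= IHp !linearZ /=; congr (_ *: _ + _).
rewrite mpolyXE_id !rmorph_prod.
apply: eq_bigr => i _ /=; rewrite !rmorphXn /= !lin_substX.
by rewrite lin_subst_linform row_mul.
Qed.

Lemma lin_subst1 p : lin_subst 1%:M p = p.
Proof.
rewrite -[RHS]comp_mpoly_id /lin_subst; congr (_ \mPo _).
by apply: eq_from_tnth => i; rewrite !tnth_mktuple row1 linform_delta.
Qed.

Lemma dhomog_linform x : linform x \is 1.-homog.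
Proof.
by apply: rpred_sum => j _; apply: rpredZ; rewrite dhomogX /= mdeg1.
Qed.

Lemma lin_subst_homog P d p :
  {in msupp p, forall m : 'X_{1..n}, (2 * mdeg m)%N = d} ->
  {in msupp (lin_subst P p), forall m : 'X_{1..n}, (2 * mdeg m)%N = d}.
Proof.
move=> pd m; apply: contraTeq => md; rewrite -mcoeff_eq0 /lin_subst comp_mpolyEX.
rewrite raddf_sum /= big_seq big1 // => m' /pd m'd.
rewrite mcoeffZ comp_mpolyX; set q := \prod_i _.
have qhom : q \is (mdeg m').-homog.
  rewrite mdegE; apply: (big_ind2 (fun q d => q \is d.-homog)).
  - exact: dhomog1.
  - by move=> q1 d1 q2 d2; apply: dhomogM.
  move=> i _; rewrite tnth_mktuple -[X in X.-homog]mul1n.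
  exact/dhomogMn/dhomog_linform.
rewrite (dhomog_nemf_coeff qhom) ?mulr0 //=.
by apply: contra md => /eqP mm'; rewrite mm' m'd.
Qed.

Lemma presents_lin_subst T S P p : is_sltm T -> is_sltm S -> presents T S P ->
  sltm_pi T p = 0 -> sltm_pi S (lin_subst P p) = 0.
Proof.
move=> Tlow Slow [Pu PS] /sltm_pi_eq0[c ->].
rewrite [lin_subst _ _]rmorph_sum rmorph_sum big1 // => i _ /=.
rewrite (sltm_relE _ Tlow) !rmorphM /= !lin_subst_linform.
rewrite mulmxBl -rowE -[X in _ * X]rmorphM /=.
have /(sltm_pi_linform2 _ _ Slow) -> := PS i.
by rewrite mulr0.
Qed.

Section Isomorphism.
Variables (T S P : 'M[F]_n).
Hypotheses (Tlow : is_sltm T) (Slow : is_sltm S) (PTS : presents T S P).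

Definition sltm_map (u : sltm_alg T) : sltm_alg S :=
  sltm_pi S (lin_subst P (repr u)).

Lemma sltm_map_pi p : sltm_map (sltm_pi T p) = sltm_pi S (lin_subst P p).
Proof.
apply/eqP; rewrite -subr_eq0 -!rmorphB /=; apply/eqP.
apply: (presents_lin_subst Tlow Slow PTS); rewrite rmorphB.
by apply/eqP; rewrite subr_eq0; apply/eqP; exact: reprK.
Qed.

Lemma sltm_piK (u : sltm_alg T) : sltm_pi T (repr u) = u.
Proof. exact: reprK. Qed.

Fact sltm_map_zmod_morphism : zmod_morphism sltm_map.
Proof.
move=> u v; rewrite -[u]sltm_piK -[v]sltm_piK -rmorphB !sltm_map_pi.
by rewrite !rmorphB.
Qed.

Fact sltm_map_monoid_morphism : monoid_morphism sltm_map.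
Proof.
split=> [|u v]; first by rewrite -(rmorph1 (sltm_pi T)) sltm_map_pi !rmorph1.
rewrite -[u]sltm_piK -[v]sltm_piK -rmorphM !sltm_map_pi.
by rewrite !rmorphM.
Qed.

Fact sltm_map_scalable : scalable sltm_map.
Proof.
move=> a u; rewrite -[u]sltm_piK -linearZ !sltm_map_pi.
by rewrite !linearZ.
Qed.

Definition sltm_lrmorphism : {lrmorphism sltm_alg T -> sltm_alg S} :=
  HB.pack sltm_map
    (GRing.isZmodMorphism.Build _ _ sltm_map sltm_map_zmod_morphism)
    (GRing.isMonoidMorphism.Build _ _ sltm_map sltm_map_monoid_morphism)
    (GRing.isScalable.Build _ _ _ *:%R sltm_map sltm_map_scalable).

End Isomorphism.

(** The inverse isomorphism is the substitution by [invmx P]; that it respects the relations of S is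
    the content of [presents_sym]. *)
Lemma presents_sltm_equiv T S P : is_sltm T -> is_sltm S ->
  presents T S P -> sltm_equiv T S.
Proof.
move=> Tlow Slow PTS; have Pu := PTS.1.
have PST := presents_sym two_neq0 Tlow Slow PTS.
exists (sltm_lrmorphism Tlow Slow PTS); split.
  exists (@sltm_map S T (invmx P)) => u /=.
    rewrite -[u]sltm_piK (sltm_map_pi Tlow Slow PTS) (sltm_map_pi Slow Tlow PST).
    by rewrite lin_subst_comp mulmxV // lin_subst1.
  rewrite -[u]sltm_piK (sltm_map_pi Slow Tlow PST) (sltm_map_pi Tlow Slow PTS).
  by rewrite lin_subst_comp mulVmx // lin_subst1.
move=> d u [p pd <-]; exists (lin_subst P p); first exact: lin_subst_homog pd.
by rewrite /= (sltm_map_pi Tlow Slow PTS).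
Qed.

End Bridge.
End DegreeTwo.

(** * Sorted sequences and supports *)

(** An injection of a finite set into itself is a permutation, so both sequences list the same
    multiset in sorted order. *)
Lemma nondecreasing_perm_eq n (f g : 'I_n -> nat) (s : 'I_n -> 'I_n) :
    (forall i j : 'I_n, (i <= j)%N -> (f i <= f j)%N) ->
    (forall i j : 'I_n, (i <= j)%N -> (g i <= g j)%N) ->
    injective s -> (forall i, f i = g (s i)) ->
  f =1 g.
Proof.
move=> f_mono g_mono s_inj fgs.
have map_sorted (h : 'I_n -> nat) :
    (forall i j : 'I_n, (i <= j)%N -> (h i <= h j)%N) ->
    sorted leq [seq h i | i <- enum 'I_n].
  move=> h_mono; rewrite sorted_map.
  apply: (@sub_sorted _ (relpre val leq)) => [i j /h_mono //|].
  by rewrite -sorted_map val_enum_ord iota_sorted.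
have eq_fg : [seq f i | i <- enum 'I_n] = [seq g i | i <- enum 'I_n].
  apply: (sorted_eq leq_trans anti_leq); try exact: map_sorted.
  rewrite (eq_map fgs) (map_comp g s); apply: perm_map.
  apply: uniq_perm; rewrite ?(map_inj_uniq s_inj) ?enum_uniq // => i.
  by rewrite mem_enum; apply/mapP; exists (invF s_inj i);
    rewrite ?mem_enum ?f_invF.
by move=> i; have /eq_in_map -> := eq_fg; rewrite ?mem_enum.
Qed.

(** If the support of [f] has two elements, each [i] in it has a partner [k] with [f i * f k]
    nonzero, which forces [g i] to be nonzero; by symmetry the supports coincide. Otherwise
    nonemptiness leaves exactly one element in each. *)
Lemma card_support_products (R : idomainType) (I : finType) (B : {set I})
    (f g : I -> R) :
    {in B &, forall i k, i != k -> f i * f k = g i * g k} ->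
    (exists2 i, i \in B & f i != 0) -> (exists2 i, i \in B & g i != 0) ->
  #|[set i in B | f i != 0]| = #|[set i in B | g i != 0]|.
Proof.
pose supp (h : I -> R) := [set i in B | h i != 0]; rewrite -!/(supp _).
have sub (f' g' : I -> R) :
    {in B &, forall i k, i != k -> f' i * f' k = g' i * g' k} ->
    (1 < #|supp f'|)%N ->
    supp f' \subset supp g'.
  move=> fg f1; apply/fintype.subsetP => i iB.
  move: f1; rewrite (cardsD1 i) iB ltnS => /card_gt0P[k].
  move: iB; rewrite !inE => /andP[iB fi] /and3P[ki kB fk]; rewrite iB.
  have := fg i k iB kB; rewrite eq_sym ki => /(_ isT) E.
  have := mulf_neq0 fi fk; rewrite E; apply: contraNneq => ->.
  by rewrite mul0r.
move=> fg [i iB fi] [k kB gk].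
have gf : {in B &, forall i k, i != k -> g i * g k = f i * f k}.
  by move=> p q pB qB pq; rewrite fg.
have f0 : (0 < #|supp f|)%N.
  by apply/card_gt0P; exists i; rewrite inE iB.
have g0 : (0 < #|supp g|)%N.
  by apply/card_gt0P; exists k; rewrite inE kB.
have [f1|f1] := ltnP 1 #|supp f|.
  have /subset_leq_card fg_card := sub f g fg f1.
  have /subset_leq_card gf_card := sub g f gf (leq_trans f1 fg_card).
  by apply/eqP; rewrite eqn_leq fg_card.
have [g1|g1] := ltnP 1 #|supp g|; last by lia.
by have /subset_leq_card := sub g f gf g1; lia.
Qed.

(** * Levels and their invariance under a change of basis *)

Section Levels.
Variables (F : fieldType) (n : nat).
Implicit Types (S T P : 'M[F]_n) (x y u v : 'rV[F]_n) (lev : 'I_n -> nat).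

Definition is_leader S (r c : 'I_n) : Prop :=
  S r c != 0 /\ forall l : 'I_n, (c < l)%N -> S r l = 0.

Definition irreducible_leaders S : Prop := forall r c, is_leader S r c ->
  exists2 i : 'I_n, (i < c)%N & 2 * S r i + S r c * S c i != 0.

Lemma leader_exists S r l : S r l != 0 ->
  exists2 c : 'I_n, is_leader S r c & (l <= c)%N.
Proof.
move=> Srl; have [c Src c_max] := @arg_maxnP _ l (fun j => S r j != 0) val Srl.
exists c; last exact: c_max.
split=> // j cj; apply: contraTeq cj => /c_max; rewrite -leqNgt.
exact.
Qed.

(* lev r is the index of the block containing r: r lies in [r_j, r_(j+1)[ of
   the wall exactly when lev r = j. *)
Record leveled S lev : Prop := Leveled {
  lev_sltm : is_sltm S;
  lev_mono : forall i j : 'I_n, (i <= j)%N -> (lev i <= lev j)%N;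
  lev_entry : forall r l, S r l != 0 -> (lev l < lev r)%N;
  lev_pred : forall r, (0 < lev r)%N -> exists2 l, S r l != 0 & (lev l).+1 = lev r;
  lev_irr : irreducible_leaders S }.

(** Membership in the space [E_j], seen as the span of the [X_l] of level below [j]. *)
Definition below lev j x : Prop := forall l, x 0 l != 0 -> (lev l < j)%N.

Lemma below_lin lev j a b x y : below lev j x -> below lev j y ->
  below lev j (a *: x + b *: y).
Proof.
move=> xj yj l; rewrite !mxE; have [x0|/xj //] := eqVneq (x 0 l) 0.
have [y0|/yj //] := eqVneq (y 0 l) 0.
by rewrite x0 y0 !mulr0 addr0 eqxx.
Qed.

Lemma below_sum lev j x P : (forall l, x 0 l != 0 -> below lev j (row l P)) ->
  below lev j (x *m P).
Proof.
move=> xP l; rewrite mxE => xPl; apply/negPn/negP => lj.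
case/eqP: xPl; apply: big1 => k _.
have [->|xk] := eqVneq (x 0 k) 0; first by rewrite mul0r.
have [Pkl|Pkl] := eqVneq (P k l) 0; first by rewrite Pkl mulr0.
by case/negP: lj; apply: (xP k xk); rewrite mxE.
Qed.

Lemma top_exists x a : x 0 a != 0 ->
  exists m : 'I_n,
    [/\ x 0 m != 0, forall l : 'I_n, (m < l)%N -> x 0 l = 0 & (a <= m)%N].
Proof.
move=> xa; have [m xm m_max] := @arg_maxnP _ a (fun j => x 0 j != 0) val xa.
exists m; split=> [//|l ml|]; last exact: m_max.
by apply: contraTeq ml => /m_max; rewrite -leqNgt.
Qed.

(** The measure of row [r] on the block just below its own. With the successor on the left, a row of
    level 0 gets measure 0. *)
Definition level_mu S lev (r : 'I_n) : nat :=
  #|[set l | (S r l != 0) && ((lev l).+1 == lev r)]|.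

Definition mu_sorted S lev : Prop := forall i k : 'I_n, (i <= k)%N ->
  lev i = lev k -> (level_mu S lev i <= level_mu S lev k)%N.

Hypothesis two_neq0 : 2 != 0 :> F.

(* Let m be the top index of x.  The coefficients at X_a X_m turn x (x - u) = 0
   into 2 x - u = x_m (2 X_m - L_m), where X_m^2 = L_m X_m; squaring gives
   u^2 = x_m^2 L_m^2, so an irreducible leader of L_m has level < j. *)
Section TopIndex.
Variables (S : 'M[F]_n) (lev : 'I_n -> nat) (j : nat) (x u : 'rV[F]_n) (m : 'I_n).
Hypotheses (levS : leveled S lev) (uj : below lev j u).
Hypotheses (xu : orth S x (x - u)) (xm : x 0 m != 0).
Hypotheses (m_max : forall l : 'I_n, (m < l)%N -> x 0 l = 0).
Hypothesis jm : (j <= lev m)%N.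

Lemma top_coef (a : 'I_n) : (a < m)%N -> 2 * x 0 a = u 0 a - x 0 m * S m a.
Proof.
move=> am; have um : u 0 m = 0.
  by apply/eqP/negPn/negP => /uj; rewrite ltnNge jm.
have := xu am; rewrite /qform ![(x - u) _ _]mxE ![(- u) _ _]mxE um => E.
apply: (mulfI xm); apply/eqP; rewrite -subr_eq0 -[X in _ == X]E.
by apply/eqP; ring.
Qed.

Lemma top_level : lev m = j.
Proof.
apply/eqP; rewrite eqn_leq jm andbT leqNgt; apply/negP => j_lt_m.
(* If [j < lev m], the leader column [c] of row [m] has level at least [j], so [u] vanishes at
   [c]. *)
have [l Sml levl] := lev_pred levS (leq_ltn_trans (leq0n j) j_lt_m).
have [c c_lead lc] := leader_exists Sml; have [Smc _] := c_lead.
have cm : (c < m)%N.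
  by rewrite ltnNge; apply: contra Smc => /(lev_sltm levS) ->.
have uc : u 0 c = 0.
  apply/eqP/negPn/negP => /uj; have := lev_mono levS lc; lia.
have [i ic irr] := lev_irr levS c_lead.
have := xu ic; rewrite /qform ![(x - u) _ _]mxE ![(- u) _ _]mxE uc => E.
have xc2 := top_coef cm; have xi2 := top_coef (ltn_trans ic cm).
rewrite uc sub0r in xc2.
(* Up to sign, this product is twice the coefficient of [x (x - u)] at [X_i X_c], by [top_coef] at
   [i] and at [c]. Irreducibility makes it nonzero. *)
have : x 0 c * (2 * S m i + S m c * S c i) * x 0 m = 0.
  have -> : x 0 c * (2 * S m i + S m c * S c i) * x 0 m =
     2 * (x 0 c * (x 0 m * S m i)) - S c i * x 0 c * - (x 0 m * S m c) by ring.
  rewrite -xc2.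
  have -> : x 0 m * S m i = u 0 i - 2 * x 0 i by rewrite xi2; ring.
  by rewrite -[RHS](mulr0 (- 2)) -[in RHS]E; ring.
apply/eqP; rewrite !mulf_neq0 //.
apply: contraNneq xm => xc0; move: xc2; rewrite xc0 mulr0 => /eqP.
by rewrite eq_sym oppr_eq0 mulf_eq0 (negPf Smc) orbF.
Qed.

(** At an index [a < m] of level at least [j], both [u] and row [m] vanish, the latter because its
    entries have level below [lev m = j]; then [top_coef] reads [2 x_a = 0]. *)
Lemma top_below : below lev j (x - x 0 m *: delta_mx 0 m).
Proof.
move=> a; rewrite !mxE eqxx /=; have [->|am] := eqVneq a m.
  by rewrite mulr1 subrr eqxx.
rewrite mulr0 subr0 => xa; have {}am : (a < m)%N.
  rewrite ltn_neqAle am leqNgt; apply/negP => /m_max /eqP.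
  by rewrite (negPf xa).
have := top_coef am; rewrite ltnNge => E; apply/negP => ja.
have u0 : u 0 a = 0 by apply/eqP/negPn/negP => /uj; rewrite ltnNge ja.
have S0 : S m a = 0.
  apply/eqP/negPn/negP => /(lev_entry levS); rewrite top_level; lia.
move: E; rewrite u0 S0 mulr0 subr0 => /eqP.
by rewrite mulf_eq0 (negPf two_neq0) (negPf xa).
Qed.

(** Half the coefficient of [X_i X_k] in [u^2 = x_m^2 L_m^2], where [S k i = 0] removes the
    contribution of [X_k^2]. *)
Lemma top_products (i k : 'I_n) : (i < k)%N -> (k < m)%N -> S k i = 0 ->
  u 0 i * u 0 k = (x 0 m * S m i) * (x 0 m * S m k).
Proof.
move=> ik km Ski; have := xu ik.
rewrite /qform ![(x - u) _ _]mxE ![(- u) _ _]mxE Ski => E.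
have xi := top_coef (ltn_trans ik km); have xk := top_coef km.
apply/(mulfI two_neq0)/eqP; rewrite -subr_eq0.
have -> : 2 * (u 0 i * u 0 k) - 2 * (x 0 m * S m i * (x 0 m * S m k)) =
    (u 0 i - x 0 m * S m i) * (u 0 k + x 0 m * S m k)
    + (u 0 k - x 0 m * S m k) * (u 0 i + x 0 m * S m i) by ring.
have -> : u 0 i + x 0 m * S m i = 2 * u 0 i - 2 * x 0 i by rewrite xi; ring.
have -> : u 0 k + x 0 m * S m k = 2 * u 0 k - 2 * x 0 k by rewrite xk; ring.
by rewrite -xi -xk -[X in _ == X](mulr0 (- 4)) -[in X in _ == X]E; apply/eqP; ring.
Qed.

End TopIndex.

(** A coordinate of level above [j] would give a top index of such a level, which [top_level] forces
    to be [j]. *)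
Lemma orth_below S lev j x u : leveled S lev -> below lev j u ->
  orth S x (x - u) -> below lev j.+1 x.
Proof.
move=> levS uj xu a xa; rewrite ltnNge; apply/negP => ja.
have [m [xm m_max am]] := top_exists xa.
have jm : (j < lev m)%N by apply: leq_trans (lev_mono levS am).
by have := top_level levS uj xu xm (ltnW jm); lia.
Qed.

(** Row [l] of [P] satisfies [Y (Y - u) = 0] with [u] the image of row [l] of [S1], which involves
    lower levels only; [orth_below] thus climbs one level at a time. *)
Lemma presents_below S1 S2 lev1 lev2 P j x :
    leveled S1 lev1 -> leveled S2 lev2 -> presents S1 S2 P ->
  below lev1 j x -> below lev2 j (x *m P).
Proof.
move=> lev1S lev2S [Pu PS]; elim: j x => [|j IHj] x xj; apply: below_sum => l /xj //.
rewrite ltnS => lj; apply: orth_below lev2S _ (PS l); apply: IHj => k.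
by rewrite mxE => /(lev_entry lev1S) kl; apply: leq_trans kl lj.
Qed.

Section Comparison.
Variables (S1 S2 P : 'M[F]_n) (lev1 lev2 : 'I_n -> nat).
Hypotheses (levS1 : leveled S1 lev1) (levS2 : leveled S2 lev2).
Hypothesis PS : presents S1 S2 P.

Let PV : presents S2 S1 (invmx P) :=
  presents_sym two_neq0 (lev_sltm levS1) (lev_sltm levS2) PS.

Let below_rowS r : below lev2 (lev1 r) (row r S1 *m P).
Proof.
apply: (presents_below levS1 levS2 PS) => l; rewrite mxE.
exact: lev_entry levS1 _ _.
Qed.

Lemma below_presentsE j x : below lev2 j (x *m P) -> below lev1 j x.
Proof. by move/(presents_below levS2 levS1 PV); rewrite mulmxK ?PS.1. Qed.

Lemma top_index_exists r : exists m : 'I_n,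
  [/\ P r m != 0, forall l : 'I_n, (m < l)%N -> P r l = 0, lev2 m = lev1 r
    & below lev2 (lev1 r) (row r P - P r m *: delta_mx 0 m)].
Proof.
(* Otherwise the inverse change of basis would bring [Y_r] back to [X_r] lying below its own
   level. *)
have [a Pra ja] : exists2 a, P r a != 0 & (lev1 r <= lev2 a)%N.
  apply: contrapT => nex.
  have /below_presentsE/(_ r) : below lev2 (lev1 r) (delta_mx 0 r *m P).
    rewrite -rowE => l; rewrite mxE => Prl; rewrite ltnNge; apply/negP => rl.
    by apply: nex; exists l.
  by rewrite mxE !eqxx oner_neq0 ltnn => /(_ isT).
have /top_exists[m [Prm m_max am]] : row r P 0 a != 0 by rewrite mxE.
rewrite mxE in Prm.
have m_max' (l : 'I_n) : (m < l)%N -> row r P 0 l = 0 by exact: m_max.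
have jm : (lev1 r <= lev2 m)%N by apply: leq_trans ja (lev_mono levS2 am).
have rm : row r P 0 m != 0 by rewrite mxE.
have rS := PS.2 r.
exists m; split=> // [l ml||].
- by have := m_max l ml; rewrite mxE.
- exact: (top_level levS2 (@below_rowS r) rS rm jm).
- have := top_below levS2 (@below_rowS r) rS rm m_max' jm.
  by rewrite [row r P 0 m]mxE.
Qed.

Lemma level_matching : exists s : 'I_n -> 'I_n,
  [/\ injective s, forall r, lev1 r = lev2 (s r)
    & forall r, level_mu S1 lev1 r = level_mu S2 lev2 (s r)].
Proof.
have [s sP] := choice top_index_exists; exists s.
(* Two rows with the same top index have a combination without that coordinate. It drops below their
   common level, although its preimage keeps a nonzero coordinate at [r]. *)
have s_inj : injective s.
  move=> r r' ss; apply: contrapT => rr'.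
  have [Pr _ lr br] := sP r; have [Pr' _ lr' br'] := sP r'.
  rewrite -lr in br; rewrite -lr' -ss in br'; rewrite -ss in Pr'.
  have := below_lin (a := P r' (s r)) (b := - P r (s r)) br br'.
  have -> : P r' (s r) *: (row r P - P r (s r) *: delta_mx 0 (s r)) +
      - P r (s r) *: (row r' P - P r' (s r) *: delta_mx 0 (s r)) =
      (P r' (s r) *: delta_mx 0 r - P r (s r) *: delta_mx 0 r') *m P.
    rewrite mulmxBl -!scalemxAl -!rowE.
    by apply/rowP => k; rewrite !mxE; ring.
  move=> /below_presentsE/(_ r); rewrite !mxE !eqxx /=.
  have -> : (r == r') = false by apply/eqP.
  by rewrite mulr1 mulr0 subr0 Pr' lr ltnn => /(_ isT).
split=> // [r|r]; first by have [_ _ ->] := sP r.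
have [Prm m_max lr _] := sP r; set m := s r in Prm m_max lr *.
rewrite /level_mu lr; have [r0|r_gt0] := posnP (lev1 r).
  by rewrite r0; congr #|pred_of_set _|; apply/setP => l; rewrite !inE !andbF.
pose u := row r S1 *m P.
(* Only row [p] contributes at [s p]: any other row in the support of row [r] has its own top index
   elsewhere and its remaining coordinates in lower levels. Hence [s] matches the support of row [r]
   of [S1], in the level just below, with that of [u]. *)
have u_s p : (lev1 p).+1 = lev1 r -> u 0 (s p) = S1 r p * P p (s p).
  move=> pr; rewrite /u mxE (bigD1 p) //= mxE big1 ?addr0 // => k kp.
  rewrite mxE; have [->|/(lev_entry levS1) kr] := eqVneq (S1 r k) 0.
    by rewrite mul0r.
  have [_ _ _ /(_ (s p))] := sP k; rewrite !mxE eqxx /=.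
  have -> : (s p == s k) = false by apply/eqP => /s_inj pk; rewrite pk eqxx in kp.
  rewrite mulr0 subr0; have [->|_ /(_ isT)] := eqVneq (P k (s p)) 0.
    by rewrite mulr0.
  by have [_ _ -> _] := sP p; lia.
pose B := [set i | (lev2 i).+1 == lev1 r].
have lev_s p : lev2 (s p) = lev1 p by have [_ _ ->] := sP p.
have Ps p : P p (s p) != 0 by have [] := sP p.
have -> : [set l | S1 r l != 0 & (lev1 l).+1 == lev1 r] =
    s @^-1: [set i in B | u 0 i != 0].
  apply/setP => p; rewrite !inE lev_s andbC; case: eqP => //= pr.
  by rewrite u_s // mulf_eq0 negb_or Ps andbT.
rewrite card_preimset //.
have -> : [set l | S2 m l != 0 & (lev2 l).+1 == lev1 r] =
    [set i in B | P r m * S2 m i != 0].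
  by apply/setP => p; rewrite !inE mulf_eq0 negb_or Prm andbC.
have rm : row r P 0 m != 0 by rewrite mxE.
have jm : (lev1 r <= lev2 m)%N by rewrite lr.
apply: (@card_support_products F _ B (fun i => u 0 i)).
- have main (i k : 'I_n) : i \in B -> k \in B -> (i < k)%N ->
      u 0 i * u 0 k = P r m * S2 m i * (P r m * S2 m k).
    rewrite !inE => /eqP iB /eqP kB ik.
    have km : (k < m)%N.
      by rewrite ltnNge; apply/negP => /(lev_mono levS2); lia.
    have Ski : S2 k i = 0.
      by apply/eqP/negPn/negP => /(lev_entry levS2); lia.
    have := top_products (@below_rowS r) (PS.2 r) rm jm ik km Ski.
    by rewrite [row r P 0 m]mxE.
  move=> i k iB kB; rewrite neq_ltn => /orP[ik|ki]; first exact: main.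
  by rewrite mulrC (main k i) // mulrC.
- have [p Srp pr] := lev_pred levS1 r_gt0.
  exists (s p); first by rewrite inE lev_s pr.
  by rewrite u_s // mulf_neq0.
- rewrite -lr in r_gt0; have [p Smp pm] := lev_pred levS2 r_gt0.
  by exists p; [rewrite inE pm lr | rewrite mulf_neq0].
Qed.

Lemma leveled_unique : lev1 =1 lev2.
Proof.
have [s [s_inj s_lev _]] := level_matching.
exact: (nondecreasing_perm_eq (lev_mono levS1) (lev_mono levS2) s_inj).
Qed.

Lemma level_mu_unique : mu_sorted S1 lev1 -> mu_sorted S2 lev2 ->
  level_mu S1 lev1 =1 level_mu S2 lev2.
Proof.
move=> sort1 sort2; have [s [s_inj s_lev s_mu]] := level_matching.
(* Level and measure as a two-digit number in base [n.+1], a measure being at most [n]. *)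
pose key S lev (i : 'I_n) := (lev i * n.+1 + level_mu S lev i)%N.
have mu_le S lev i : (level_mu S lev i <= n)%N.
  by rewrite /level_mu (leq_trans (max_card _)) ?card_ord.
have key_mono S lev : leveled S lev -> mu_sorted S lev ->
    forall i j : 'I_n, (i <= j)%N -> (key S lev i <= key S lev j)%N.
  move=> levS sortS i j ij; rewrite /key.
  have := lev_mono levS ij; rewrite leq_eqVlt => /orP[/eqP E|lt_ij].
    by rewrite E leq_add2l sortS.
  have := mu_le S lev i; nia.
have E : key S1 lev1 =1 key S2 lev2.
  apply: (nondecreasing_perm_eq (s := s)) => //; try exact: key_mono.
  by move=> i; rewrite /key s_lev s_mu.
by move=> i; have := E i; rewrite /key leveled_unique; lia.
Qed.

End Comparison.
End Levels.

(** * The first reduced echelon form in terms of leaders *)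

Section Leads.
Variables (F : fieldType) (n : nat).
Implicit Types (S T P : 'M[F]_n).

Lemma ord_of_range r : (1 <= r <= n)%N -> exists i : 'I_n, r = i.+1.
Proof. by case: r => // r rn; exists (Ordinal rn). Qed.

Definition lead S (i : 'I_n) : nat := \max_(l | S i l != 0) l.+1.

Lemma leader_colE S (i : 'I_n) : leader_col S i.+1 = lead S i.
Proof.
rewrite /leader_col big_add1 big_mkord.
by apply: eq_bigl => l; rewrite entryE.
Qed.

Lemma ltn_lead S i l : S i l != 0 -> (l < lead S i)%N.
Proof.
exact: (@leq_bigmax_cond _ (fun l => S i l != 0) (fun l : 'I_n => l.+1) l).
Qed.

Lemma lead_is_leader S r c : is_leader S r c -> lead S r = c.+1.
Proof.
move=> [Src c_max]; apply/eqP; rewrite eqn_leq ltn_lead // andbT.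
apply/bigmax_leqP => l; rewrite ltnS leqNgt; apply: contra => cl.
exact/eqP/c_max.
Qed.

Lemma lead_leader S r : (0 < lead S r)%N ->
  exists2 c, is_leader S r c & lead S r = c.+1.
Proof.
have [l Srl|row0] := pickP (fun l => S r l != 0); last by rewrite /lead big_pred0.
have [c c_lead _] := leader_exists Srl.
by exists c => //; apply: lead_is_leader.
Qed.

Lemma row_nonzeroE S (i : 'I_n) : row_nonzero S i.+1 = (0 < lead S i)%N.
Proof.
apply/hasP/idP => [[c]|/lead_leader[c [Sic _] _]].
  rewrite mem_index_iota => /ord_of_range[l ->].
  by rewrite entryE => /ltn_lead; apply: leq_ltn_trans.
by exists c.+1; rewrite ?mem_index_iota ?ltnS ?ltn_ord ?entryE.
Qed.

Lemma lead_sltm S i : is_sltm S -> (lead S i <= i)%N.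
Proof.
move=> Slow; apply/bigmax_leqP => l; apply: contraR.
by rewrite -ltnNge ltnS => /Slow ->.
Qed.

Lemma leaders_irreducibleE S : is_sltm S ->
  leaders_irreducible S <-> irreducible_leaders S.
Proof.
move=> Slow; split=> irr.
  move=> r c c_lead; have rn : (1 <= r.+1 <= n)%N by rewrite ltn_ord.
  have lc := lead_is_leader c_lead.
  have [|_ [i]] := irr r.+1 c.+1.
    by split; rewrite ?row_nonzeroE ?leader_colE ?lc.
  move=> /andP[i1 ic]; have [|k ki] := @ord_of_range i.
    by rewrite i1 (leq_trans (ltnW ic)).
  by rewrite ki in ic *; rewrite /Delta !entryE; exists k.
move=> r c [/ord_of_range[i ->]]; rewrite row_nonzeroE leader_colE => i0 ->.
have [k k_lead ->] := lead_leader i0; have [l lk nz] := irr _ _ k_lead.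
split; first by rewrite ltnS (leq_trans _ lk).
by exists l.+1; rewrite ?ltnS // /Delta !entryE.
Qed.

Lemma consecutive_mono (f : 'I_n -> nat) (p : pred 'I_n) :
    (forall i j k : 'I_n, (i <= j <= k)%N -> p i -> p k -> p j) ->
    (forall i j : 'I_n, p i -> p j -> j = i.+1 :> nat -> (f i <= f j)%N) ->
  forall i j : 'I_n, p i -> p j -> (i <= j)%N -> (f i <= f j)%N.
Proof.
move=> p_conv f_cons i j; have [d jE] : exists d, d = (j - i)%N by exists (j - i)%N.
elim: d i jE => [|d IHd] i jE pi pj ij.
  by have -> : i = j by apply: val_inj => /=; lia.
have i1n : (i.+1 < n)%N by have := ltn_ord j; lia.
have pi1 : p (Ordinal i1n) by apply: (p_conv i _ j) => //=; lia.
apply: leq_trans (f_cons i (Ordinal i1n) pi pi1 erefl) _.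
by apply: IHd => //=; lia.
Qed.

(** As zero rows have [lead] 0, this merges the two order conditions of 1-REF: zero rows on top, and
    nondecreasing leader columns. *)
Definition lead_mono S : Prop :=
  forall i j : 'I_n, (i <= j)%N -> (lead S i <= lead S j)%N.

Lemma is_1REF_intro S : is_sltm S -> lead_mono S -> irreducible_leaders S ->
  is_1REF S.
Proof.
move=> Slow Smono Sirr; split=> //; right; split.
- move=> r s /ord_of_range[i ->] /ord_of_range[j ->]; rewrite !row_nonzeroE.
  by move=> i0 j0; rewrite ltnS ltnNge; apply/negP => /Smono; lia.
- exact/leaders_irreducibleE.
- move=> r c c' [/ord_of_range[i ->] _ ->] [/ord_of_range[j jE] _ ->].
  by rewrite jE !leader_colE Smono //; lia.
Qed.

Lemma is_1REF_elim S : is_1REF S ->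
  [/\ is_sltm S, lead_mono S & irreducible_leaders S].
Proof.
move=> [Slow [S0|[zero irr mono]]]; split=> //.
- by move=> i j _; rewrite /lead S0 !big_pred0 // => l; rewrite mxE eqxx.
- by move=> r c []; rewrite S0 mxE eqxx.
- move=> i j; apply: (@consecutive_mono _ predT) => // {}i {}j _ _ ij.
  have [E|i0] := posnP (lead S i); first by rewrite E.
  rewrite -!leader_colE; have rn (k : 'I_n) : (1 <= k.+1 <= n)%N by rewrite ltn_ord.
  have j0 : row_nonzero S j.+1.
    apply/negPn/negP => j0; have := zero j.+1 i.+1 (rn j) (rn i) j0.
    by rewrite row_nonzeroE => /(_ i0); lia.
  apply: (mono i.+1); first by split; rewrite ?row_nonzeroE ?rn.
  by rewrite -ij; split; rewrite ?rn.
- exact/leaders_irreducibleE.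
Qed.

End Leads.

(* Base B digits, so that comparing weights is comparing lexicographically. *)
Fixpoint weight (B : nat) (f : nat -> nat) (m : nat) : nat :=
  if m is k.+1 then weight B f k * B + f k else 0.

Lemma ltn_weight B (f g : nat -> nat) r m : (forall i, f i < B)%N -> (r < m)%N ->
    (forall i, (i < r)%N -> f i = g i) -> (f r < g r)%N ->
  (weight B f m < weight B g m)%N.
Proof.
move=> fB rm fg fgr; elim: m rm => //= m IHm; rewrite ltnS leq_eqVlt.
move=> /orP[/eqP <-|rm]; last by have := IHm rm; have := fB m; nia.
suff E k : (k <= r)%N -> weight B f k = weight B g k by rewrite (E r) // ltn_add2l.
by elim: k => //= k IHk kr; rewrite IHk ?fg // ltnW.
Qed.

(** * Reduction to 1-REF by decreasing weight *)

Section Reduction.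
Variables (F : fieldType) (n : nat).
Implicit Types (S T P : 'M[F]_n).

Lemma orth_row T i : is_sltm T -> orth T (delta_mx 0 i) (delta_mx 0 i - row i T).
Proof.
by move=> Tlow; have := (presents_refl Tlow).2 i; rewrite row1 mulmx1.
Qed.

(** The termination measure. The top row is the most significant digit, so a step may disturb the
    rows below the one whose leader it lowers. *)
Definition lead_weight T : nat := weight n.+1 (fun i => leader_col T i.+1) n.

Lemma ltn_lead_weight T T' (r : 'I_n) :
    (forall i : 'I_n, (i < r)%N -> lead T' i = lead T i) ->
    (lead T' r < lead T r)%N ->
  (lead_weight T' < lead_weight T)%N.
Proof.
move=> eq_lead lt_lead; apply: (@ltn_weight _ _ _ r) => //=.
- move=> i; rewrite /leader_col big_add1 big_mkord ltnS.
  by apply/bigmax_leqP => l _.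
- move=> i ir; have iE := ltn_trans ir (ltn_ord r).
  by have := eq_lead (Ordinal iE) ir; rewrite -!leader_colE.
- by rewrite !leader_colE.
Qed.

Definition conj_perm T (s : 'S_n) : 'M[F]_n := \matrix_(i, j) T (s i) (s j).

Lemma presents_perm T (s : 'S_n) : is_sltm T ->
  presents (conj_perm T s) T (perm_mx s).
Proof.
move=> Tlow; split=> [|i]; first exact: unitmx_perm.
have -> : row i (perm_mx s) = delta_mx 0 (s i) :> 'rV[F]_n.
  by apply/rowP => k; rewrite !mxE eqxx eq_sym.
have -> : row i (conj_perm T s) *m perm_mx s = row (s i) T.
  rewrite -[s in perm_mx s]invgK -col_permE.
  by apply/rowP => k; rewrite !mxE; congr (T _ _); rewrite permKV.
exact: orth_row.
Qed.

(** Since [lead T j < lead T i <= i], row [j] has no entry in column [i], so exchanging the two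
    generators keeps the matrix strictly lower triangular. *)
Lemma swap_step T (i j : 'I_n) : is_sltm T -> j = i.+1 :> nat ->
    (lead T j < lead T i)%N ->
  exists T' P, [/\ is_sltm T', presents T' T P
    & (lead_weight T' < lead_weight T)%N].
Proof.
move=> Tlow ij lt_lead; pose s := tperm i j.
have leadi := lead_sltm i Tlow.
have Tj (l : 'I_n) : (lead T j <= l)%N -> T j l = 0.
  by move=> jl; apply/eqP/negPn/negP => /ltn_lead; lia.
exists (conj_perm T s), (perm_mx s); split; last first.
- apply: (@ltn_lead_weight T _ i) => [a ai|].
    have nai : i != a by apply/eqP => E; move: ai; rewrite E ltnn.
    have naj : j != a by apply/eqP => E; move: ai; rewrite -E ij; lia.
    apply: eq_bigl => l; rewrite mxE /s tpermD //.
    by case: tpermP => // ->; rewrite !Tlow //; lia.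
  apply: leq_ltn_trans (lt_lead); apply/bigmax_leqP => l; rewrite mxE /s tpermL.
  case: tpermP => [->|->|_ _ /ltn_lead //].
  - by rewrite (Tlow j j) ?eqxx.
  - by rewrite Tj ?eqxx //; lia.
- exact: presents_perm.
have neq (x y : 'I_n) : x <> y -> (x : nat) <> y by move=> xy /val_inj.
move=> a b ab; rewrite mxE /s.
case: tpermP => [aE|aE|/neq ai /neq aj]; case: tpermP => [bE|bE|/neq bi /neq bj];
  rewrite ?aE ?bE in ab *; first [by rewrite Tj //; lia | apply: Tlow; lia].
Qed.

Hypothesis two_neq0 : 2 != 0 :> F.

(* The hypothesis says that L_r = 2 t X_c - t L_c; the product below is then
   (X_r^2 - L_r X_r) + t^2 (X_c^2 - L_c X_c). *)
Lemma reducible_orth T r c : is_sltm T -> is_leader T r c ->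
    (forall i : 'I_n, (i < c)%N -> 2 * T r i + T r c * T c i = 0) ->
    let t := T r c / 2 in
  orth T (delta_mx 0 r - t *: delta_mx 0 c + t *: row c T)
    (delta_mx 0 r - t *: delta_mx 0 c).
Proof.
move=> Tlow [Trc c_max] red t a b ab.
have rowr : row r T = (2 * t) *: delta_mx 0 c - t *: row c T.
  apply/rowP => l; rewrite !mxE eqxx /=.
  have tE : 2 * t = T r c by rewrite /t mulrC divfK.
  have [->|lc] := eqVneq l c; first by rewrite (Tlow c c) // tE mulr1 mulr0 subr0.
  have [lt_lc|] := ltnP l c.
    apply: (mulfI two_neq0); have := red l lt_lc; rewrite -tE => /eqP.
    by rewrite addr_eq0 => /eqP ->; rewrite mulr0; ring.
  rewrite leq_eqVlt => /orP[/eqP E|cl]; first by case/eqP: lc; apply: val_inj.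
  by rewrite c_max // (Tlow c l) ?(ltnW cl) // !mulr0 subr0.
have := orth_row r Tlow ab; have := orth_row c Tlow ab.
rewrite rowr /qform !mxE => Ec Er.
rewrite -[RHS]addr0 -[X in _ = X + _]Er.
rewrite -[X in _ = _ + X](mulr0 (t ^+ 2)) -[X in _ = _ + _ * X]Ec.
by ring.
Qed.

(** The generator [Y = X_r - t X_c + t L_c] satisfies [Y (Y - t L_c) = 0], and [L_c] involves only
    indices below [c]; replacing [X_r] by [Y] lowers the leader of row [r] and leaves the rows above
    alone. *)
Lemma reducible_step T r c : is_sltm T -> is_leader T r c ->
    (forall i : 'I_n, (i < c)%N -> 2 * T r i + T r c * T c i = 0) ->
  exists T' P, [/\ is_sltm T', presents T' T P
    & (lead_weight T' < lead_weight T)%N].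
Proof.
move=> Tlow c_lead red; have orth_r := reducible_orth Tlow c_lead red.
move: orth_r; set t := T r c / 2; cbv zeta => orth_r.
have [Trc c_max] := c_lead.
have cr : (c < r)%N by rewrite ltnNge; apply: contra Trc => /Tlow ->.
pose z : 'rV[F]_n := t *: row c T - t *: delta_mx 0 c.
(* The rows of [D] are the new linear forms written in the old generators; [T'] below rewrites them
   in the new ones. *)
pose D := \matrix_i (if i == r then t *: row c T else row i T).
have DE i : row i D = if i == r then t *: row c T else row i T by rewrite rowK.
have Dr (i : 'I_n) : (i <= r)%N -> D i r = 0.
  rewrite mxE; case: eqP => [_|/eqP ne] ir; rewrite !mxE.
    by rewrite (Tlow c r) ?mulr0 // ltnW.
  by rewrite Tlow.
have z0 (j : 'I_n) : (c < j)%N -> z 0 j = 0.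
  move=> cj; rewrite !mxE (Tlow c j) ?(ltnW cj) //.
  have -> : (j == c) = false by apply/eqP => E; rewrite E ltnn in cj.
  by rewrite andbF !mulr0 subr0.
have zr : z *m delta_mx r 0 = 0 :> 'M_1.
  by apply/rowP => k; rewrite -colE [LHS]mxE z0 // mxE.
pose e : 'cV[F]_n := delta_mx r 0.
(* As [z] has no coordinate at [r], the inverse of [P] is [1%:M - e *m z], and [T'] is [D] times
   this inverse. *)
pose P := 1%:M + e *m z; pose T' := D - D *m e *m z.
have T'P : T' *m P = D.
  rewrite /T' /P mulmxDr mulmx1 mulmxBl !mulmxA -[_ *m z *m e]mulmxA zr.
  by rewrite mulmx0 mul0mx subr0 subrK.
have T'E i j : T' i j = D i j - D i r * z 0 j.
  rewrite /T' /e -colE mxE [in X in _ + X]mxE [in X in _ + X]mxE big_ord1.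
  by rewrite [col _ _ _ _]mxE.
exists T', P; split.
- move=> i j ij; rewrite T'E.
  have [ir|ri] := leqP i r.
    rewrite Dr // mul0r subr0 mxE; case: eqP ij => [->|_] ij; rewrite !mxE.
      by rewrite (Tlow c j) ?mulr0 // (leq_trans (ltnW cr)).
    by rewrite Tlow.
  rewrite z0 ?mulr0 ?subr0; last by lia.
  rewrite mxE; case: eqP ri => [->|_] ri; last by rewrite mxE Tlow.
  by rewrite ltnn in ri.
- split.
    have : P *m (1%:M - e *m z) = 1%:M.
      rewrite /P mulmxDl mul1mx [e *m z *m _]mulmxBr mulmx1.
      by rewrite -mulmxA [z *m _]mulmxA zr mul0mx mulmx0 subr0 subrK.
    by case/mulmx1_unit.
  move=> i; rewrite -row_mul T'P DE.
  have -> : row i P = delta_mx 0 i + (if i == r then z else 0).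
    rewrite /P raddfD /= row1 row_mul; congr (_ + _).
    have -> : row i e = (i == r)%:R%:M.
      by apply/rowP => k; rewrite !ord1 !mxE !eqxx andbT.
    by rewrite mul_scalar_mx; case: eqP; rewrite ?scale1r ?scale0r.
  case: eqP => [->|_]; last by rewrite addr0; apply: orth_row.
  have -> : delta_mx 0 r + z - t *: row c T = delta_mx 0 r - t *: delta_mx 0 c.
    by rewrite /z; apply/rowP => k; rewrite !mxE; ring.
  by rewrite /z [t *: row c T - _]addrC addrA.
- apply: (@ltn_lead_weight T T' r) => [i ir|].
    apply: eq_bigl => l; rewrite T'E Dr ?(ltnW ir) // mul0r subr0 mxE.
    have -> : (i == r) = false by apply/eqP => E; rewrite E ltnn in ir.
    by rewrite mxE.
  rewrite (lead_is_leader c_lead) ltnS; apply/bigmax_leqP => l.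
  rewrite T'E Dr // mul0r subr0 mxE eqxx !mxE; apply: contraR.
  by rewrite -leqNgt => cl; rewrite (Tlow c l) ?mulr0.
Qed.

(** A matrix whose weight cannot be lowered is in 1-REF: a drop of leaders between consecutive rows
    would allow [swap_step], a reducible leader [reducible_step]. *)
Lemma exists_1REF T : is_sltm T ->
  exists S, is_1REF S /\ exists P, presents S T P.
Proof.
have [m] := ubnP (lead_weight T); elim: m T => // m IHm T lt_m Tlow.
have [step|no_step] := pselect (exists T' P, [/\ is_sltm T', presents T' T P
    & (lead_weight T' < lead_weight T)%N]).
  have [T' [P [T'low PT T'm]]] := step.
  have [S [SREF [Q PS]]] := IHm T' (leq_trans T'm lt_m) T'low.
  by exists S; split=> //; exists (Q *m P); apply: presents_trans PS PT.
exists T; split; last by exists 1%:M; apply: presents_refl.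
apply: is_1REF_intro => //.
  move=> i j; apply: (@consecutive_mono _ _ predT) => // {}i {}j _ _ ij.
  by rewrite leqNgt; apply/negP => /(swap_step Tlow ij).
move=> r c c_lead; apply: contrapT => nex; apply: no_step.
apply: (reducible_step Tlow c_lead) => i ic; apply/eqP/negPn/negP => nz.
by apply: nex; exists i.
Qed.

End Reduction.

(** * Levels of a 1-REF and its wall *)

Section Walls.
Variables (F : fieldType) (n : nat).
Implicit Types (S T V P : 'M[F]_n) (lev : 'I_n -> nat).

(** Length of a longest chain of nonzero entries starting in row [i], cut off at [k]. For an SLTM
    the indices decrease along a chain, so fuel [n] is enough. *)
Fixpoint level_upto S (k : nat) (i : 'I_n) : nat :=
  if k is k'.+1 then \max_(l | S i l != 0) (level_upto S k' l).+1 else 0.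

Definition level S : 'I_n -> nat := level_upto S n.

Lemma level_rec S i : is_sltm S ->
  level S i = \max_(l | S i l != 0) (level S l).+1.
Proof.
move=> Slow; suff stable k (l : 'I_n) : (l < k)%N ->
    level_upto S k.+1 l = level_upto S k l by rewrite /level -stable.
elim: k l => // k IHk l lk; rewrite [LHS]/= [RHS]/=; apply: eq_bigr => p Slp.
have pl : (p < l)%N by rewrite ltnNge; apply: contra Slp => /Slow ->.
by rewrite -IHk //; apply: leq_trans pl lk.
Qed.

Lemma leveled_1REF S : is_1REF S -> leveled S (level S).
Proof.
move=> /is_1REF_elim[Slow Smono Sirr]; split=> //.
- suff mono k : forall i j : 'I_n, (i <= j)%N ->
      (level_upto S k i <= level_upto S k j)%N by exact: mono.
  elim: k => //= k IHk i j ij.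
  apply/bigmax_leqP => l /ltn_lead li.
  have i0 := leq_ltn_trans (leq0n l) li.
  (* Every column in the support of row [i] is at most the leader column [c] of row [j], so a chain
     from row [i] is dominated by one through [c]. *)
  have [c [Sjc _] cE] := lead_leader (leq_trans i0 (Smono _ _ ij)).
  apply: leq_trans (@leq_bigmax_cond _ _ (fun l => (level_upto S k l).+1) c Sjc).
  by rewrite ltnS IHk // -ltnS -cE (leq_trans li) ?Smono.
- move=> r l Srl; rewrite [level S r]level_rec //.
  exact: (@leq_bigmax_cond _ (fun l => S r l != 0) (fun l => (level S l).+1) l Srl).
- move=> r; rewrite level_rec // => r0.
  have [l Srl|row0] := pickP (fun l => S r l != 0); last by rewrite big_pred0 in r0.
  have [|k Srk ->] := @eq_bigmax_cond _ (fun l => S r l != 0) (fun l => (level S l).+1).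
    by apply/card_gt0P; exists l.
  by exists k.
Qed.

(** For nondecreasing [lev] this is the number of indices of level below [j], so its successor is
    the wall entry [r_j], including [r_0 = 1] and [r_(h+1) = n + 1]. *)
Definition below_count lev (j : nat) : nat := \max_(i | (lev i < j)%N) i.+1.

Definition top_level_of lev : nat := \max_(i : 'I_n) lev i.

Definition wall_of lev : seq nat :=
  [seq (below_count lev j).+1 | j <- iota 1 (top_level_of lev)].

Section LeveledWall.
Variables (S : 'M[F]_n) (lev : 'I_n -> nat).
Hypothesis levS : leveled S lev.

Lemma ltn_below_count j (i : 'I_n) : (i < below_count lev j)%N = (lev i < j)%N.
Proof.
apply/idP/idP => [|ij]; last first.
  exact: (@leq_bigmax_cond _ (fun i => lev i < j)%N (fun i : 'I_n => i.+1) i).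
apply: contraTT; rewrite -!leqNgt => ji; apply/bigmax_leqP => k kj.
by rewrite ltnNge; apply/negP => /(lev_mono levS); lia.
Qed.

Lemma below_count_le j : (below_count lev j <= n)%N.
Proof. by apply/bigmax_leqP => i _. Qed.

Lemma below_count0 : below_count lev 0 = 0%N.
Proof. exact: big_pred0. Qed.

Lemma lev_le_top i : (lev i <= top_level_of lev)%N.
Proof. exact: (@leq_bigmax _ lev i). Qed.

Lemma top_level_attained : (0 < n)%N -> exists i, lev i = top_level_of lev.
Proof.
rewrite /top_level_of => n0.
have [|i ->] := @eq_bigmax _ lev; first by rewrite card_ord.
by exists i.
Qed.

Lemma below_count_full j : (top_level_of lev < j)%N -> below_count lev j = n.
Proof.
move=> hj; apply/eqP; rewrite eqn_leq below_count_le /=.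
case: (posnP n) => [->//|n0]; rewrite -ltnS -[X in (X < _)%N](prednK n0) ltnS.
have pn : (n.-1 < n)%N by rewrite prednK.
have := ltn_below_count j (Ordinal pn); rewrite /= => ->.
by rewrite (leq_ltn_trans (lev_le_top _)).
Qed.

Lemma below_count_ltn j : (0 < n)%N -> (j <= top_level_of lev)%N ->
  (below_count lev j < n)%N.
Proof.
move=> /top_level_attained[i iE] jh; apply: leq_ltn_trans (ltn_ord i).
by rewrite leqNgt ltn_below_count iE -leqNgt.
Qed.

(** No level is skipped: if the least index of level at least [j] had a larger level, its row would
    have an entry at a smaller index, again of level at least [j]. *)
Lemma below_count_incr j : (below_count lev j < n)%N ->
  (below_count lev j < below_count lev j.+1)%N.
Proof.
move=> jn; have := ltn_below_count j.+1 (Ordinal jn); rewrite /= => ->.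
rewrite ltnS leqNgt; apply/negP => j_lt.
have [l /(ltn_lead) Sl llev] := lev_pred levS (leq_ltn_trans (leq0n _) j_lt).
have := lead_sltm (Ordinal jn) (lev_sltm levS); rewrite /= => leadj.
have : (l < below_count lev j)%N by lia.
by rewrite ltn_below_count; lia.
Qed.

Lemma lev_le_index i : (lev i <= i)%N.
Proof.
have [m] := ubnP (i : nat); elim: m i => // m IHm i; rewrite ltnS => im.
have [->//|/(lev_pred levS)[l Sil <-]] := posnP (lev i).
have li : (l < i)%N.
  by rewrite ltnNge; apply: contra Sil => /(lev_sltm levS) ->.
by apply: leq_ltn_trans (li); apply: IHm; apply: leq_trans li im.
Qed.

(** Counting from 1, this reads [c_r >= r_j] iff [r >= r_(j+1)], which is the recursion defining the
    wall. *)
Lemma lead_below_count j i :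
  (below_count lev j < lead S i)%N = (below_count lev j.+1 <= i)%N.
Proof.
rewrite [RHS]leqNgt ltn_below_count -leqNgt; apply/idP/idP => [ji|].
  have [c c_lead cE] := lead_leader (leq_ltn_trans (leq0n _) ji).
  have [Sic _] := c_lead; apply: leq_trans (lev_entry levS Sic).
  by rewrite ltnS leqNgt -ltn_below_count -leqNgt -ltnS -cE.
move=> ji; have [l Sil llev] := lev_pred levS (leq_ltn_trans (leq0n _) ji).
apply: leq_ltn_trans (ltn_lead Sil).
by rewrite leqNgt ltn_below_count; lia.
Qed.

Lemma filter_index_iota a b m (p : pred nat) : (a <= b)%N ->
    (forall s, (a <= s < m)%N -> p s = (b <= s)%N) ->
  [seq s <- index_iota a m | p s] = index_iota b m.
Proof.
move=> ab pE; rewrite (@eq_in_filter _ _ (leq b)); last first.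
  by move=> s; rewrite mem_index_iota => /pE.
have [bm|mb] := leqP b m; last first.
  rewrite /index_iota (_ : m - b = 0)%N; last by lia.
  apply/eqP; rewrite -(negbK (_ == _)) -has_filter; apply/hasPn => s.
  by rewrite mem_index_iota; lia.
rewrite /index_iota; have -> : (m - a = (b - a) + (m - b))%N by lia.
rewrite iotaD filter_cat subnKC // (_ : filter _ (iota a _) = [::]).
  by apply/all_filterP/allP => s; rewrite mem_iota; lia.
apply/eqP; rewrite -(negbK (_ == _)) -has_filter; apply/hasPn => s.
by rewrite mem_iota; lia.
Qed.

Lemma wall_1REF_wall_of : S != 0 -> wall_1REF S = wall_of lev.
Proof.
move=> S0; have n0 : (0 < n)%N.
  rewrite lt0n; apply: contraNneq S0 => n0.
  by apply/eqP/matrixP => i; have := ltn_ord i; lia.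
have h0 : (0 < top_level_of lev)%N.
  have [i [l Sil]] : exists i l, S i l != 0.
    apply: contrapT => nex; case/eqP: S0; apply/matrixP => i l; rewrite mxE.
    by apply/eqP/negPn/negP => Sil; apply: nex; exists i, l.
  exact: leq_trans (leq_ltn_trans (leq0n _) (lev_entry levS Sil)) (lev_le_top i).
pose h := top_level_of lev; pose d := below_count lev.
rewrite /wall_1REF (@filter_index_iota 1 (d 1%N).+1); last first.
- move=> s /ord_of_range[i ->]; rewrite row_nonzeroE ltnS -lead_below_count.
  by rewrite below_count0.
- by [].
have iota_cons j : (j <= h)%N ->
    index_iota (d j).+1 n.+1 = (d j).+1 :: index_iota (d j).+2 n.+1.
  move=> /(below_count_ltn n0) jn; rewrite /index_iota subSS.
  by case E : (n - d j)%N => [|k]; [rewrite /d in E; lia | congr (_ :: iota _ _); lia].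
rewrite iota_cons //.
have chain k j : (0 < j)%N -> (h - j <= k)%N -> (j <= h)%N -> min_chain (fun r =>
     [seq s <- index_iota r.+1 n.+1 | (r <= leader_col S s)%N]) k (d j).+1 =
    [seq (d i).+1 | i <- iota j (h - j).+1].
  elim: k j => [|k IHk] j j0 hjk jh.
    by rewrite /=; have -> : (h - j = 0)%N by lia.
  rewrite /= (@filter_index_iota _ (d j.+1).+1); last first.
  - move=> s /andP[s1 s2]; have [|i iE] := @ord_of_range n s; first by lia.
    by rewrite iE leader_colE ltnS -lead_below_count.
  - by rewrite ltnS below_count_incr // below_count_ltn.
  move: jh; rewrite leq_eqVlt => /orP[/eqP jh|jh].
    have -> : d j.+1 = n by apply: below_count_full; rewrite jh.
    by rewrite /index_iota subnn jh subnn.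
  rewrite iota_cons //= IHk //; try by lia.
  by have -> : (h - j = (h - j.+1).+1)%N by lia.
rewrite chain //; last first.
- have [i iE] := top_level_attained n0; rewrite /h -iE.
  by have := lev_le_index i; have := ltn_ord i; lia.
- by rewrite /wall_of -/h; have -> : ((h - 1).+1 = h)%N by rewrite /h; lia.
Qed.

End LeveledWall.
End Walls.
Lemma min_chain_eq (f g : nat -> nat) N k a :
    (forall r, (a <= r < N)%N -> f r = g r) -> (a < N)%N ->
  [seq (r, f r) | r <- min_chain
     (fun r => [seq s <- index_iota r.+1 N | (f r < f s)%N]) k a] =
  [seq (r, g r) | r <- min_chain
     (fun r => [seq s <- index_iota r.+1 N | (g r < g s)%N]) k a].
Proof.
elim: k a => [|k IHk] a fg aN /=; first by rewrite fg ?leqnn.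
rewrite fg ?leqnn //; congr (_ :: _).
have -> : [seq s <- index_iota a.+1 N | (g a < f s)%N] =
          [seq s <- index_iota a.+1 N | (g a < g s)%N].
  by apply: eq_in_filter => s; rewrite mem_index_iota => sN; rewrite fg //; lia.
case E : [seq s <- _ | _] => [|s l] //.
have : s \in s :: l by rewrite inE eqxx.
rewrite -E mem_filter mem_index_iota => /andP[_ sN].
by apply: IHk => [r rN|]; [apply: fg; lia | lia].
Qed.

(** * The second reduced echelon form *)

Section SecondForm.
Variables (F : fieldType) (n : nat).
Implicit Types (S T V P : 'M[F]_n) (lev : 'I_n -> nat).

Lemma count_index_iota (p : pred nat) a b : (0 < a)%N -> (b <= n.+1)%N ->
  count p (index_iota a b) = #|[set l : 'I_n | p l.+1 & (a <= l.+1 < b)%N]|.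
Proof.
move=> a0 bn; rewrite -size_filter cardE -(size_map (fun l : 'I_n => l.+1)).
apply/perm_size/uniq_perm.
- by rewrite filter_uniq ?iota_uniq.
- by rewrite map_inj_uniq ?enum_uniq // => i j [/val_inj].
move=> r; rewrite mem_filter mem_index_iota; apply/andP/mapP.
  move=> [pr rab]; have [|i rE] := @ord_of_range n r; first by lia.
  by exists i; rewrite // mem_enum inE -rE pr.
by move=> [i]; rewrite mem_enum inE => /andP[pi iab] ->.
Qed.

Lemma exists_sorting_perm (f : 'I_n -> nat) : exists s : {perm 'I_n},
  forall i j : 'I_n, (i <= j)%N -> (f (s i) <= f (s j))%N.
Proof.
pose r := relpre f leq; pose t := sort_tuple r (ord_tuple n).
have t_inj : injective (tnth t).
  by apply/tuple_uniqP; rewrite sort_uniq val_ord_tuple enum_uniq.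
exists (perm t_inj) => i j ij; rewrite !permE.
have r_trans : transitive r by move=> p q u; apply: leq_trans.
have t_sorted : sorted r t by apply: sort_sorted => p q; apply: leq_total.
have t_size (k : 'I_n) : (k : nat) \in [pred p | (p < size t)%N].
  by rewrite inE size_tuple.
have r_refl : reflexive r by move=> p; apply: leqnn.
have := sorted_leq_nth r_trans r_refl i t_sorted _ _ (t_size i) (t_size j) ij.
by rewrite -!tnth_nth.
Qed.

(** The existence clause supplies a reduced matrix at which any two candidate values are evaluated,
    so the choice made by [xget] is [w]. *)
Lemma wallE T w : has_wall T w -> wall T = w.
Proof.
move=> Tw; have [[S SREF TS] uw] := Tw.
have [_ u] : has_wall T (wall T) by apply: (@xgetPex _ [::] (has_wall T)); exists w.
by rewrite -(u S SREF TS) (uw S SREF TS).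
Qed.

Lemma measure_seqE T m : has_measure T m -> measure_seq T = m.
Proof.
move=> Tm; have [[V VREF TV] uV] := Tm.
have [_ u] : has_measure T (measure_seq T).
  by apply: (@xgetPex _ [::] (has_measure T)); exists m.
by rewrite -(u V VREF TV) (uV V VREF TV).
Qed.

Lemma entry_exists S : S != 0 -> exists i l, S i l != 0.
Proof.
move=> S_neq0; apply: contrapT => nex; case/eqP: S_neq0.
apply/matrixP => i l; rewrite mxE.
by apply/eqP/negPn/negP => Sil; apply: nex; exists i, l.
Qed.

Section FixedLevel.
Variables (S : 'M[F]_n) (lev : 'I_n -> nat).
Hypothesis levS : leveled S lev.

Section FixedMatrix.
Variable V : 'M[F]_n.
Hypotheses (Vlow : is_sltm V) (V_wall : wall V = wall_of lev).

Lemma size_wall : size (wall V) = top_level_of lev.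
Proof. by rewrite V_wall size_map size_iota. Qed.

Lemma wall_atE j : wall_at V j = (below_count lev j).+1.
Proof.
rewrite /wall_at V_wall /wall_of; case: j => [|j] /=; first by rewrite below_count0.
have [jh|hj] := ltnP j (top_level_of lev).
  by rewrite (nth_map 0) ?size_iota // nth_iota.
by rewrite nth_default ?size_map ?size_iota // (below_count_full levS).
Qed.

Lemma in_wall_block j (i : 'I_n) :
  (wall_at V j <= i.+1 < wall_at V j.+1)%N = (lev i == j).
Proof.
rewrite !wall_atE !ltnS (ltn_below_count levS) ltnS leqNgt.
by rewrite (ltn_below_count levS) -leqNgt eqn_leq andbC.
Qed.

Lemma mu_wallE j (i : 'I_n) : (0 < j)%N -> lev i = j ->
  mu_wall V j i.+1 = level_mu V lev i.
Proof.
case: j => // j _ ij; rewrite /mu_wall /mu /= count_index_iota; first last.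
- by rewrite wall_atE ltnS below_count_le.
- by rewrite wall_atE.
rewrite /level_mu ij; congr #|pred_of_set _|; apply/setP => l.
by rewrite !inE entryE in_wall_block eqSS.
Qed.

Lemma card_level0 : #|[set l : 'I_n | lev l == 0%N]| = below_count lev 1.
Proof.
have := @count_index_iota predT 1 (below_count lev 1).+1 isT.
rewrite ltnS below_count_le count_predT size_iota subSS subn0 => /(_ isT) E.
rewrite [RHS]E; congr #|pred_of_set _|; apply/setP => l.
by rewrite !inE /= !ltnS (ltn_below_count levS) ltnS leqn0.
Qed.

Lemma count_zero_rows :
  count (fun r => ~~ row_nonzero V r) (index_iota 1 n.+1) =
  #|[set l : 'I_n | lead V l == 0%N]|.
Proof.
rewrite count_index_iota //; congr #|pred_of_set _|; apply/setP => l.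
by rewrite !inE row_nonzeroE -eqn0Ngt /= ltnS ltn_ord andbT.
Qed.

Lemma leveled_lead_eq0 : leveled V lev ->
  forall l, (lead V l == 0%N) = (lev l == 0%N).
Proof.
move=> levV l; rewrite -[LHS]negbK -lt0n -[RHS]negbK -lt0n; congr (~~ _).
apply/idP/idP => [/lead_leader[c [/(lev_entry levV) + _] _]|]; first by lia.
by move=> /(lev_pred levV)[k /ltn_lead + _]; lia.
Qed.

Lemma leveled_leader r c : leveled V lev -> is_leader V r c ->
  lev r = (lev c).+1.
Proof.
move=> levV [Vrc c_max]; have cr := lev_entry levV Vrc.
have [l Vrl lr] := lev_pred levV (leq_ltn_trans (leq0n _) cr).
have lc : (l <= c)%N by rewrite leqNgt; apply: contra Vrl => /c_max ->.
by have := lev_mono levV lc; lia.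
Qed.

Lemma is_2REF_intro : ~ sltm_equiv V 0 -> leveled V lev -> mu_sorted V lev ->
  is_2REF V.
Proof.
move=> V_n0 levV sortV; split=> //; right; split=> //.
have zeroE := leveled_lead_eq0 levV; split.
- split.
    rewrite count_zero_rows wall_atE subn1 /= -card_level0.
    by congr #|pred_of_set _|; apply/setP => l; rewrite !inE zeroE.
  move=> r s /ord_of_range[i ->] /ord_of_range[j ->]; rewrite !row_nonzeroE.
  rewrite -eqn0Ngt zeroE lt0n zeroE ltnS => /eqP i0 j0.
  by rewrite ltnNge; apply/negP => /(lev_mono levV); lia.
- split; first exact/leaders_irreducibleE/lev_irr/levV.
  move=> j r /andP[j0 _] jr; have [|i iE] := @ord_of_range n r.
    by move: jr; rewrite !wall_atE; have := below_count_le lev j.+1; lia.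
  move: jr; rewrite iE in_wall_block => /eqP ij.
  have [|c c_lead cE] := @lead_leader _ _ V i.
    by rewrite lt0n zeroE ij -lt0n.
  rewrite leader_colE cE -[X in _ && (_ < wall_at V X)%N](prednK j0) in_wall_block.
  by have := leveled_leader levV c_lead; rewrite ij => ->.
- move=> j r /andP[j0 _] jr; have := jr; rewrite !wall_atE subn1 /= => jr'.
  have [|i iE] := @ord_of_range n r; first by have := below_count_le lev j.+1; lia.
  have [|k kE] := @ord_of_range n r.+1; first by have := below_count_le lev j.+1; lia.
  have ij : lev i = j by apply/eqP; rewrite -in_wall_block !wall_atE; lia.
  have kj : lev k = j by apply/eqP; rewrite -in_wall_block !wall_atE; lia.
  by rewrite kE iE !mu_wallE // sortV ?ij //; lia.
Qed.

Lemma is_2REF_elim : V != 0 -> is_2REF V -> leveled V lev /\ mu_sorted V lev.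
Proof.
move=> V0 [_ [/eqP|[_]]]; first by rewrite (negPf V0).
move=> [[zero_count _] [/(leaders_irreducibleE Vlow) irr block] sorted_mu].
have leadE i : (0 < lev i)%N ->
    exists2 c, is_leader V i c & (lev c).+1 = lev i.
  move=> i0; have := block (lev i) i.+1; rewrite size_wall i0 lev_le_top.
  rewrite in_wall_block eqxx leader_colE => /(_ isT isT) li.
  have [|c c_lead cE] := @lead_leader _ _ V i.
    by apply: leq_trans (proj1 (andP li)); rewrite wall_atE.
  exists c => //; move: li.
  rewrite cE -[X in _ && (_ < wall_at V X)%N](prednK i0) in_wall_block => /eqP ->.
  exact: prednK.
(* Rows of positive level are nonzero, and there are as many zero rows as rows of level 0, so the
   two sets agree. *)
have zeroE l : (lead V l == 0%N) = (lev l == 0%N).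
  suff /setP/(_ l) : [set l | lead V l == 0%N] = [set l | lev l == 0%N].
    by rewrite !inE.
  apply/eqP; rewrite eqEcard -count_zero_rows zero_count wall_atE subn1 /=.
  rewrite card_level0 leqnn andbT; apply/fintype.subsetP => k; rewrite !inE.
  apply: contraLR; rewrite -!lt0n => /leadE[c /lead_is_leader -> _].
  by [].
have levV : leveled V lev.
  split=> //; first exact: lev_mono levS.
    move=> r l Vrl; have := ltn_lead Vrl; case: (posnP (lev r)) => [/eqP|r0].
      by rewrite -zeroE => /eqP ->.
    have [c c_lead <-] := leadE r r0; rewrite (lead_is_leader c_lead) !ltnS.
    exact: lev_mono levS _ _.
  by move=> r /leadE[c [Vrc _] cr]; exists c.
split=> // i k ik lev_ik.
have [i0|i0] := posnP (lev i).
  by rewrite {1}/level_mu i0 eq_card0 // => l; rewrite !inE andbF.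
apply: (@consecutive_mono _ _ (fun l => lev l == lev i)) => //; last 1 first.
- by rewrite lev_ik.
- move=> a b c /andP[ab bc] /eqP ai /eqP ci.
  by have := lev_mono levS ab; have := lev_mono levS bc; lia.
move=> a b /eqP ai /eqP bi ab.
rewrite -(mu_wallE i0 ai) -(mu_wallE i0 bi) ab; apply: sorted_mu.
  by rewrite size_wall i0 lev_le_top.
have := in_wall_block (lev i) a; rewrite ai eqxx => /andP[-> _] /=.
by have := in_wall_block (lev i) b; rewrite bi eqxx => /andP[_]; rewrite ab; lia.
Qed.

End FixedMatrix.

End FixedLevel.

(** * Existence and uniqueness of the measure sequence *)

Hypothesis two_neq0 : 2 != 0 :> F.

(** Generators are permuted inside each level. Most conditions see only levels and survive, but
    columns are permuted too, so leaders may move and irreducibility needs its own argument. *)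
Lemma exists_mu_sorted S lev : leveled S lev ->
  exists V P, [/\ leveled V lev, mu_sorted V lev & presents V S P].
Proof.
move=> levS; have Slow := lev_sltm levS.
have mu_le i : (level_mu S lev i <= n)%N.
  by rewrite /level_mu (leq_trans (max_card _)) ?card_ord.
(* The level is the dominant digit of the sorting key, so the sorted levels are the original ones
   and [s] preserves levels. *)
have [s s_sort] :=
  exists_sorting_perm (fun i => lev i * n.+1 + level_mu S lev i)%N.
have lev_s : forall i, lev (s i) = lev i.
  apply: (nondecreasing_perm_eq (s := s) _ (lev_mono levS)) => //;
    last exact: perm_inj.
  by move=> i j /s_sort; have := mu_le (s i); have := mu_le (s j); nia.
pose V := conj_perm S s; have VE i j : V i j = S (s i) (s j) by rewrite mxE.
have V_entry r l : V r l != 0 -> (lev l < lev r)%N.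
  by rewrite VE => /(lev_entry levS); rewrite !lev_s.
have Vlow : is_sltm V.
  move=> i j ij; apply/eqP/negPn/negP => /V_entry.
  by have := lev_mono levS ij; lia.
have VS : presents V S (perm_mx s) by exact: presents_perm.
clearbody V.
have mu_s i : level_mu V lev i = level_mu S lev (s i).
  rewrite /level_mu -[RHS](card_preimset _ (@perm_inj _ s)).
  by congr #|pred_of_set _|; apply/setP => l; rewrite !inE VE !lev_s.
exists V, (perm_mx s); split=> //; last first.
  move=> i k /s_sort; rewrite !mu_s !lev_s => key lev_ik.
  by move: key; rewrite lev_ik leq_add2l.
split=> //; first exact: lev_mono levS.
  move=> r; rewrite -lev_s => /(lev_pred levS)[l Srl <-].
  exists ((s^-1)%g l); first by rewrite VE permKV.
  by rewrite -[in LHS]lev_s permKV.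
(* A reducible leader would put the r-th basis vector one level lower. *)
move=> r c c_lead; apply: contrapT => nex; have [Vrc _] := c_lead.
have red (i : 'I_n) : (i < c)%N -> 2 * V r i + V r c * V c i = 0.
  by move=> ic; apply/eqP/negPn/negP => nz; apply: nex; exists i.
have := reducible_orth two_neq0 Vlow c_lead red; set t := V r c / 2; cbv zeta.
set x := _ + _ => xu; pose u := t *: row c V.
have {}xu : orth V x (x - u) by rewrite /u addrK.
have rowP_ l : row l (perm_mx s) = delta_mx 0 (s l) :> 'rV[F]_n.
  by apply/rowP => k; rewrite !mxE eqxx eq_sym.
have u_below : below lev (lev c) (u *m perm_mx s).
  apply: below_sum => l; rewrite /u !mxE => ul k; rewrite rowP_ !mxE eqxx /=.
  case: (k =P s l) => [-> _|_]; last by rewrite eqxx.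
  by rewrite lev_s; apply: V_entry; apply: contraNneq ul => ->; rewrite mulr0.
have := presents_orth Vlow VS xu; rewrite mulmxBl.
move=> /(orth_below two_neq0 levS u_below)/(_ (s r)).
have cr : (c < r)%N by rewrite ltnNge; apply: contra Vrc => /Vlow ->.
have -> : (x *m perm_mx s) 0 (s r) = 1.
  rewrite -[s in perm_mx s]invgK -col_permE mxE permK /x !mxE !eqxx /=.
  rewrite Vlow ?(ltnW cr) //.
  have -> : (r == c) = false by apply/eqP => E; rewrite E ltnn in cr.
  by rewrite !mulr0 subr0 addr0.
rewrite oner_neq0 lev_s => /(_ isT).
by have := V_entry r c Vrc; lia.
Qed.

(** Any 1-REF equivalent to [V] is presented by [S], so [leveled_unique] gives it the levels of [S].
    It is nonzero because some level is positive, and its wall depends on the levels alone. *)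
Lemma wall_presents S lev V P : is_1REF S -> leveled S lev -> S != 0 ->
  is_sltm V -> presents S V P -> wall V = wall_of lev.
Proof.
move=> S_REF levS S_neq0 Vlow SV; have Slow := lev_sltm levS; apply: wallE; split.
  exists S => //; apply: (presents_sltm_equiv two_neq0 Vlow Slow).
  exact: presents_sym SV.
move=> S' S'REF; have [S'low _ _] := is_1REF_elim S'REF.
move=> /(sltm_equiv_presents two_neq0 Vlow S'low)[Q VS'].
have levS' := leveled_1REF S'REF.
have SS' := presents_trans Vlow SV VS'.
have lev_eq := leveled_unique two_neq0 levS levS' SS'.
have S'0 : S' != 0.
  have [i [l /(lev_entry levS)]] := entry_exists S_neq0; rewrite !lev_eq => li.
  have [k S'ik _] := lev_pred levS' (leq_ltn_trans (leq0n _) li).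
  by apply: contraNneq S'ik => ->; rewrite mxE.
by rewrite (wall_1REF_wall_of levS') // (_ : level S' = lev) //; apply/funext => i.
Qed.

Lemma measure_2REF_eq lev V V' P : (0 < n)%N ->
    wall V = wall_of lev -> wall V' = wall_of lev ->
    leveled V lev -> leveled V' lev -> mu_sorted V lev -> mu_sorted V' lev ->
    presents V V' P ->
  measure_2REF V = measure_2REF V'.
Proof.
move=> n0 wV wV' levV levV' sortV sortV' VV'.
have mu_eq := level_mu_unique two_neq0 levV levV' VV' sortV sortV'.
have at_eq j : wall_at V j = wall_at V' j.
  by rewrite (wall_atE levV wV) (wall_atE levV' wV').
rewrite /measure_2REF wV wV'; apply/eq_in_map => j.
rewrite mem_index_iota size_map size_iota ltnS => /andP[j0 jh].
rewrite /measure_block !at_eq; apply: min_chain_eq.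
  move=> r rj; have [|i iE] := @ord_of_range n r.
    by move: rj; rewrite !(wall_atE levV' wV'); have := below_count_le lev j.+1; lia.
  move: rj; rewrite iE (in_wall_block levV' wV') => /eqP ij.
  by rewrite (mu_wallE levV wV) // (mu_wallE levV' wV').
rewrite !(wall_atE levV' wV') ltnS (below_count_incr levV) //.
by apply: (below_count_ltn levV).
Qed.

Lemma sltm_equiv_sym T S : is_sltm T -> is_sltm S ->
  sltm_equiv T S -> sltm_equiv S T.
Proof.
move=> Tlow Slow /(sltm_equiv_presents two_neq0 Tlow Slow)[P TS].
exact: presents_sltm_equiv (presents_sym two_neq0 Tlow Slow TS).
Qed.

Lemma sltm_equiv_trans T S U : is_sltm T -> is_sltm S -> is_sltm U ->
  sltm_equiv T S -> sltm_equiv S U -> sltm_equiv T U.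
Proof.
move=> Tlow Slow Ulow /(sltm_equiv_presents two_neq0 Tlow Slow)[P TS].
move=> /(sltm_equiv_presents two_neq0 Slow Ulow)[Q SU].
exact: presents_sltm_equiv (presents_trans Slow TS SU).
Qed.

Lemma is_sltm0 : is_sltm (0 : 'M[F]_n).
Proof. by move=> i j _; rewrite mxE. Qed.

(** All 2-REF matrices equivalent to [T] get their wall from one 1-REF [S], hence share its levels,
    and each is compared with the sorted matrix [V] built from [S]. *)
Lemma exists_measure T : is_sltm T -> ~ sltm_equiv T 0 ->
  exists m, has_measure T m.
Proof.
move=> Tlow T_n0; have [S [S_REF [P ST]]] := exists_1REF two_neq0 Tlow.
have levS := leveled_1REF S_REF; have Slow := lev_sltm levS.
have TS := presents_sym two_neq0 Slow Tlow ST.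
have S0 : S != 0.
  apply/eqP => S0; apply: T_n0; rewrite -S0.
  exact: presents_sltm_equiv TS.
have n0 : (0 < n)%N.
  by have [i _] := entry_exists S0; apply: leq_ltn_trans (ltn_ord i).
have [V [Q [levV sortV VS]]] := exists_mu_sorted levS.
have Vlow := lev_sltm levV; have SV := presents_sym two_neq0 Vlow Slow VS.
have TV := presents_trans Slow TS SV.
have TVeq := presents_sltm_equiv two_neq0 Tlow Vlow TV.
have wV := wall_presents S_REF levS S0 Vlow SV.
have V_n0 : ~ sltm_equiv V 0.
  by move=> V0; apply: T_n0; apply: sltm_equiv_trans TVeq V0 => //; apply: is_sltm0.
exists (measure_2REF V); split.
  by exists V => //; exact: (is_2REF_intro levS Vlow wV V_n0 levV sortV).
move=> V' V'REF TV'eq; have V'low := V'REF.1.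
have [R TV'] := sltm_equiv_presents two_neq0 Tlow V'low TV'eq.
have SV' := presents_trans Tlow ST TV'.
have wV' := wall_presents S_REF levS S0 V'low SV'.
have V'0 : V' != 0 by apply/eqP => V'0; apply: T_n0; rewrite -V'0.
have [levV' sortV'] := is_2REF_elim levS V'low wV' V'0 V'REF.
apply/esym; apply: (measure_2REF_eq n0 wV wV' levV levV' sortV sortV').
exact: presents_trans Slow VS SV'.
Qed.

Lemma has_measure_equiv T S m : is_sltm T -> is_sltm S -> sltm_equiv T S ->
  has_measure T m -> has_measure S m.
Proof.
move=> Tlow Slow TS [[V VREF TV] uV]; split.
  exists V => //; apply: sltm_equiv_trans TV => //; first exact: VREF.1.
  exact: sltm_equiv_sym.
move=> V' V'REF SV'; apply: uV => //; apply: sltm_equiv_trans TS SV' => //.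
exact: V'REF.1.
Qed.

End SecondForm.

Theorem corollary3p50 (F : fieldType) (hF : 2%N \notin [pchar F])
    (n : nat) (T S : 'M[F]_n) (hT : is_sltm T) (hS : is_sltm S)
    (hT0 : ~ sltm_equiv T 0) (hS0 : ~ sltm_equiv S 0)
    (hTS : sltm_equiv T S) :
  [/\ has_measure T (measure_seq T), has_measure S (measure_seq S)
    & measure_seq T = measure_seq S].
Proof.
have two_neq0 : 2 != 0 :> F by move: hF; rewrite inE.
have [m Tm] := exists_measure two_neq0 hT hT0.
have Sm := has_measure_equiv two_neq0 hT hS hTS Tm.
by rewrite (measure_seqE Tm) (measure_seqE Sm).
Qed.
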